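(* Let $H$ be a Hilbert module over a $C^*$-algebra. For every idempotent $Q\in\mathcal{L}(H)$, with matched projection $m(Q)$, we have $$\|m(Q)-Q\|\le \|Q\|=\|I-Q\|\le \|P_{\mathcal{N}(Q)}-Q\|.$$
   Context: $\mathcal{L}(H)$ is the $C^*$-algebra of adjointable operators on the Hilbert $C^*$-module $H$, and $I$ is the identity operator on $H$. $\mathcal{R}(\cdot)$ and $\mathcal{N}(\cdot)$ denote range and null space. An idempotent is $Q\in\mathcal{L}(H)$ with $Q^2=Q$; a projection is a self-adjoint idempotent. $P_{\mathcal{R}(Q)}$ and $P_{\mathcal{N}(Q)}$ are the projections of $H$ onto the (orthogonally complemented) range and null space of $Q$. Definition of the matched projection $m(Q)$ of an idempotent $Q\in\mathcal{L}(H)$: if $Q$ is a projection, $m(Q)=Q$. Otherwise, $H=\mathcal{R}(Q)\dotplus\mathcal{N}(Q^* )$ is an orthogonal decomposition; let $U:H\to\mathcal{R}(Q)\oplus\mathcal{N}(Q^* )$ be the unitary $Uh=\binom{P_{\mathcal{R}(Q)}h}{(I-P_{\mathcal{R}(Q)})h}$, let $I_1$ be the identity on $\mathcal{R}(Q)$, let $A=(Q-P_{\mathcal{R}(Q)})|_{\mathcal{N}(Q^* )}:\mathcal{N}(Q^* )\to\mathcal{R}(Q)$ and $B=(AA^*+I_1)^{1/2}$, and set $$m(Q)=U^*\cdot\frac12\begin{pmatrix}(B+I_1)B^{-1} & B^{-1}A\\ A^*B^{-1} & A^*[B(B+I_1)]^{-1}A\end{pmatrix}\cdot U .$$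
   Formalization: The equality ‖Q‖=‖I−Q‖ is stated only for Q≠0 and Q≠I, since for H≠0 it fails for these two idempotents (0 versus 1); both inequalities are stated for every idempotent. *)

(* Defs.v *)
From HB Require Import structures.
From mathcomp Require Import all_boot all_order all_algebra.
From mathcomp Require Import complex.
From mathcomp Require Import all_classical all_reals all_analysis.

Set Implicit Arguments.
Unset Strict Implicit.
Unset Printing Implicit Defensive.

Import Order.TTheory GRing.Theory Num.Theory.
Import numFieldNormedType.Exports.

Local Open Scope classical_set_scope.
Local Open Scope ring_scope.
Local Open Scope complex_scope.

(* C*-algebras are not assumed to be unital, so the product is not taken from
   the (unital) ring structures of MathComp. *)
HB.mixin Record isCStarAlgebra (R : realType) A
    of CompleteNormedModule R[i] A := {
  smul : A -> A -> A;
  star : A -> A;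
  smulA : forall a b c, smul a (smul b c) = smul (smul a b) c;
  smulDl : forall a b c, smul (a + b) c = smul a c + smul b c;
  smulDr : forall a b c, smul a (b + c) = smul a b + smul a c;
  smulZl : forall (k : R[i]) a b, smul (k *: a) b = k *: smul a b;
  smulZr : forall (k : R[i]) a b, smul a (k *: b) = k *: smul a b;
  norm_smul : forall a b, `|smul a b| <= `|a| * `|b|;
  starK : forall a, star (star a) = a;
  starD : forall a b, star (a + b) = star a + star b;
  starZ : forall (k : R[i]) a, star (k *: a) = k^* *: star a;
  starM : forall a b, star (smul a b) = smul (star b) (star a);
  norm_cstar : forall a, `|smul (star a) a| = `|a| ^+ 2
}.

#[short(type="cstarAlgType")]
HB.structure Definition CStarAlgebra (R : realType) :=
  {A of isCStarAlgebra R A & CompleteNormedModule R[i] A}.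

Definition cstar_pos (R : realType) (A : cstarAlgType R) (a : A) : Prop :=
  exists b : A, a = smul (star b) b.

(* Inner-product modules are not required to be complete: they serve as the
   type of submodules.  The inner product is linear in the second variable. *)
HB.mixin Record isInnerProductModule (R : realType) (A : cstarAlgType R) H
    of GRing.Lmodule R[i] H := {
  ract : H -> A -> H;
  inner : H -> H -> A;
  ractA : forall x a b, ract x (smul a b) = ract (ract x a) b;
  ractDl : forall x y a, ract (x + y) a = ract x a + ract y a;
  ractDr : forall x a b, ract x (a + b) = ract x a + ract x b;
  ractZl : forall (k : R[i]) x a, ract (k *: x) a = k *: ract x a;
  ractZr : forall (k : R[i]) x a, ract x (k *: a) = k *: ract x a;
  innerDr : forall x y z, inner x (y + z) = inner x y + inner x z;
  innerZr : forall (k : R[i]) x y, inner x (k *: y) = k *: inner x y;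
  inner_ract : forall x y a, inner x (ract y a) = smul (inner x y) a;
  star_inner : forall x y, star (inner x y) = inner y x;
  inner_ge0 : forall x, cstar_pos (inner x x);
  inner_eq0 : forall x, inner x x = 0 -> x = 0
}.

#[short(type="innerProdModType")]
HB.structure Definition InnerProductModule (R : realType)
    (A : cstarAlgType R) :=
  {H of isInnerProductModule R A H & GRing.Lmodule R[i] H}.

HB.mixin Record isHilbertModule (R : realType) (A : cstarAlgType R) H
    of InnerProductModule R A H & CompleteNormedModule R[i] H := {
  norm_inner : forall x : H, `|x| ^+ 2 = `|inner x x : A|
}.

#[short(type="hilbertModType")]
HB.structure Definition HilbertModule (R : realType) (A : cstarAlgType R) :=
  {H of isHilbertModule R A H & InnerProductModule R A H
      & CompleteNormedModule R[i] H}.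

Section Operators.
Context {R : realType} {A : cstarAlgType R}.

Definition is_adjoint (E F : innerProdModType A) (T : E -> F) (S : F -> E) :=
  forall x y, inner (T x) y = inner x (S y) :> A.

Definition adjointable (E F : innerProdModType A) (T : E -> F) : Prop :=
  exists S, is_adjoint T S.

Definition adjoint (E F : innerProdModType A) (T : E -> F) : F -> E :=
  xget (cst 0) [set S | is_adjoint T S].

Record adjOp (H : innerProdModType A) :=
  AdjOp { adjOp_fun :> H -> H; adjOpP : adjointable adjOp_fun }.

Definition is_idempotent (E : innerProdModType A) (T : E -> E) : Prop :=
  T \o T = T.

Definition is_projection (E : innerProdModType A) (T : E -> E) : Prop :=
  [/\ adjointable T, is_idempotent T & adjoint T = T].

(* Positivity in the C*-algebra L(E), in the same form as [cstar_pos]. *)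
Definition op_pos (E : innerProdModType A) (T : E -> E) : Prop :=
  exists2 S : E -> E, adjointable S & T = adjoint S \o S.

Definition op_sqrt (E : innerProdModType A) (T : E -> E) : E -> E :=
  xget (cst 0) [set S | op_pos S /\ S \o S = T].

Definition op_inv (E : innerProdModType A) (T : E -> E) : E -> E :=
  xget (cst 0) [set S | [/\ adjointable S, S \o T = idfun & T \o S = idfun]].

(* The operator norm is [+oo] on unbounded maps; it is finite on L(H).  The
   norm of H takes its values in the nonnegative reals of [R[i]]. *)
Definition opnorm (H : hilbertModType A) (T : H -> H) : \bar R :=
  ereal_sup [set (complex.Re `|T x|)%:E | x in [set x : H | `|x| <= 1]].

Record submodule (H : innerProdModType A) := Submodule {
  submod_set :> set H;
  submod0 : submod_set 0;
  submodD : forall x y, submod_set x -> submod_set y -> submod_set (x + y);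
  submodZ : forall (k : R[i]) x, submod_set x -> submod_set (k *: x);
  submodM : forall x (a : A), submod_set x -> submod_set (ract x a)
}.

End Operators.

Notation "''L' ( H )" := (adjOp H) (at level 8, format "''L' ( H )").

Section SubmoduleType.
Context {R : realType} {A : cstarAlgType R} {H : innerProdModType A}.
Variable V : submodule H.

Definition submod_pred : {pred H} := mem (V : set H).

Lemma submod_predP x : reflect (submod_set V x) (x \in submod_pred).
Proof. by apply: (iffP idP); rewrite in_setE. Qed.

Lemma submod_pred_closed : submod_closed submod_pred.
Proof.
split; first by apply/submod_predP; exact: submod0.
move=> k x y /submod_predP Vx /submod_predP Vy; apply/submod_predP.
by apply: submodD => //; exact: submodZ.
Qed.

HB.instance Definition _ :=
  GRing.isSubmodClosed.Build R[i] H submod_pred submod_pred_closed.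

Record submod : Type := SubmodElt {
  submod_val :> H; _ : submod_val \in submod_pred }.

HB.instance Definition _ := [isSub for submod_val].
HB.instance Definition _ := [Choice of submod by <:].
HB.instance Definition _ := [SubChoice_isSubLmodule of submod by <:].

Lemma submod_ract_subproof (x : submod) (a : A) :
  ract (val x) a \in submod_pred.
Proof.
by apply/submod_predP/submodM/submod_predP; exact: (valP x).
Qed.

Definition submod_ract (x : submod) (a : A) : submod :=
  SubmodElt (submod_ract_subproof x a).
Definition submod_inner (x y : submod) : A := inner (val x) (val y).

Lemma sub_ractA x a b :
  submod_ract x (smul a b) = submod_ract (submod_ract x a) b.
Proof. by apply/val_inj; rewrite /= ractA. Qed.
Lemma sub_ractDl x y a :
  submod_ract (x + y) a = submod_ract x a + submod_ract y a.
Proof. by apply/val_inj; rewrite /= ractDl. Qed.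
Lemma sub_ractDr x a b :
  submod_ract x (a + b) = submod_ract x a + submod_ract x b.
Proof. by apply/val_inj; rewrite /= ractDr. Qed.
Lemma sub_ractZl (k : R[i]) x a :
  submod_ract (k *: x) a = k *: submod_ract x a.
Proof. by apply/val_inj; rewrite /= ractZl. Qed.
Lemma sub_ractZr (k : R[i]) x a :
  submod_ract x (k *: a) = k *: submod_ract x a.
Proof. by apply/val_inj; rewrite /= ractZr. Qed.
Lemma sub_innerDr x y z :
  submod_inner x (y + z) = submod_inner x y + submod_inner x z.
Proof. exact: innerDr. Qed.
Lemma sub_innerZr (k : R[i]) x y :
  submod_inner x (k *: y) = k *: submod_inner x y.
Proof. exact: innerZr. Qed.
Lemma sub_inner_ract x y a :
  submod_inner x (submod_ract y a) = smul (submod_inner x y) a.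
Proof. exact: inner_ract. Qed.
Lemma sub_star_inner x y : star (submod_inner x y) = submod_inner y x.
Proof. exact: star_inner. Qed.
Lemma sub_inner_ge0 x : cstar_pos (submod_inner x x).
Proof. exact: inner_ge0. Qed.
Lemma sub_inner_eq0 x : submod_inner x x = 0 -> x = 0.
Proof. by move=> /inner_eq0 x0; apply/val_inj. Qed.

HB.instance Definition _ := isInnerProductModule.Build R A submod
  sub_ractA sub_ractDl sub_ractDr sub_ractZl sub_ractZr sub_innerDr
  sub_innerZr sub_inner_ract sub_star_inner sub_inner_ge0 sub_inner_eq0.

End SubmoduleType.

Section RangeKernel.
Context {R : realType} {A : cstarAlgType R} {H : innerProdModType A}.
Implicit Types (Q : 'L(H)) (x y z : H).

Lemma innerDl x y z : inner (x + y) z = inner x z + inner y z :> A.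
Proof. by rewrite -star_inner innerDr starD !star_inner. Qed.

Lemma innerZl (k : R[i]) x y : inner (k *: x) y = k^* *: inner x y :> A.
Proof. by rewrite -star_inner innerZr starZ star_inner. Qed.

Lemma inner_ractl x y (a : A) :
  inner (ract x a) y = smul (star a) (inner x y) :> A.
Proof. by rewrite -star_inner inner_ract starM star_inner. Qed.

Lemma inner_injl x y : (forall z, inner x z = inner y z :> A) -> x = y.
Proof.
move=> xy; apply/subr0_eq/(@inner_eq0 _ A).
by rewrite -[in X in inner X _]scaleN1r innerDl innerZl xy rmorphN1 scaleN1r subrr.
Qed.

Lemma adjOpD Q x y : Q (x + y) = Q x + Q y.
Proof.
have [S QS] := adjOpP Q.
by apply: inner_injl => z; rewrite innerDl !QS innerDl.
Qed.

Lemma adjOpZ Q (k : R[i]) x : Q (k *: x) = k *: Q x.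
Proof.
have [S QS] := adjOpP Q.
by apply: inner_injl => z; rewrite innerZl !QS innerZl.
Qed.

Lemma adjOpM Q x (a : A) : Q (ract x a) = ract (Q x) a.
Proof.
have [S QS] := adjOpP Q.
by apply: inner_injl => z; rewrite inner_ractl !QS inner_ractl.
Qed.

Lemma adjOp0 Q : Q 0 = 0.
Proof. by rewrite -[0 in LHS](scale0r 0) adjOpZ scale0r. Qed.

Lemma adjoint_adjointable Q : adjointable (adjoint Q).
Proof.
have QS : is_adjoint Q (adjoint Q) by case: (adjOpP Q) => S; exact: xgetI.
by exists Q => x y; rewrite -star_inner -QS star_inner.
Qed.

Definition adjOp_adj Q : 'L(H) := AdjOp (adjoint_adjointable Q).

Program Definition ran_mod Q : submodule H :=
  @Submodule R A H (range Q) _ _ _ _.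
Next Obligation. by move=> Q; exists 0; rewrite ?adjOp0. Qed.
Next Obligation.
by move=> Q _ _ [x _ <-] [y _ <-]; exists (x + y); rewrite ?adjOpD.
Qed.
Next Obligation.
by move=> Q k _ [x _ <-]; exists (k *: x); rewrite ?adjOpZ.
Qed.
Next Obligation.
by move=> Q _ a [x _ <-]; exists (ract x a); rewrite ?adjOpM.
Qed.

Program Definition ker_mod Q : submodule H :=
  @Submodule R A H [set x | Q x = 0] _ _ _ _.
Next Obligation. by move=> Q; rewrite /= adjOp0. Qed.
Next Obligation. by move=> Q x y /= Qx Qy; rewrite adjOpD Qx Qy addr0. Qed.
Next Obligation. by move=> Q k x /= Qx; rewrite adjOpZ Qx scaler0. Qed.
Next Obligation.
move=> Q x a /= Qx; rewrite adjOpM Qx.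
by rewrite -[0 in LHS](scale0r 0) ractZl scale0r.
Qed.

(* The projection of H onto V, for V orthogonally complemented. *)
Definition proj_onto (V : submodule H) : H -> H :=
  xget (cst 0) [set P | is_projection P /\ range P = V].

End RangeKernel.

Definition block_op (E F : zmodType) (T11 : E -> E) (T12 : F -> E)
    (T21 : E -> F) (T22 : F -> F) (v : E * F) : E * F :=
  (T11 v.1 + T12 v.2, T21 v.1 + T22 v.2).

(* The operator usually denoted A is [T] here, A being the C*-algebra.  The
   default value of [insubd 0], which corestricts to a submodule, is never used:
   P projects onto R(Q), whose orthogonal complement is the kernel of the
   adjoint of Q.  [U] is the unitary onto the orthogonal sum of these two
   submodules, so its adjoint [Ustar] is its inverse, the addition map. *)
Definition matched_projection (R : realType) (A : cstarAlgType R)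
    (H : hilbertModType A) (Q : 'L(H)) : H -> H :=
  if `[< is_projection Q >] then (Q : H -> H) else
  let E := submod (ran_mod Q) in
  let F := submod (ker_mod (adjOp_adj Q)) in
  let P := proj_onto (ran_mod Q) in
  let U : H -> E * F := fun h => (insubd 0 (P h), insubd 0 (h - P h)) in
  let Ustar : E * F -> H := fun v => val v.1 + val v.2 in
  let I1 : E -> E := idfun in
  let T : F -> E := fun x => insubd 0 (Q (val x) - P (val x)) in
  let Tstar : E -> F := adjoint T in
  let B : E -> E := op_sqrt ((T \o Tstar) \+ I1) in
  let M := block_op
    ((B \+ I1) \o op_inv B)   (op_inv B \o T)
    (Tstar \o op_inv B)       (Tstar \o op_inv (B \o (B \+ I1)) \o T) in
  fun h => Ustar (2^-1 *: M (U h)).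

(* Main.v *)
(* The order of the C*-algebra plays no role: everything takes place among
   operators on H, and rests on the triangle inequality in H.  If X and Y are
   commuting self-adjoint operators, then X + iY and X - iY have vectorwise
   equal norms, whence |Xv|^2 <= |<v, (X^2 + Y^2) v>|.  With the square root of
   1 - X, obtained by iterating y' = (X + y^2) / 2, this shows that self-adjoint
   power-bounded operators are contractions.  Applied to the rank one operators
   v |-> x<x, v>, it gives the Cauchy-Schwarz inequality, then the usual facts
   about positive operators, including the positivity of X^* X.

   For an idempotent Q <> 0, the powers of (1 - Q)^* (1 - Q) are expressed
   through those of Q^* Q, so that |1 - Q| <= |Q|.  If P is the projection onto
   N(Q), then 1 - Q = P (P - Q), which gives |1 - Q| <= |P - Q|.  Finally, let
   m be the matched projection and J = 2m - 1, a self-adjoint unitary: then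
   J (2Q - 1) is a positive operator w, of norm at most |Q| + |1 - Q| <= 2|Q|,
   and 2(m - Q) = J (1 - w) has norm at most max(1, |w| - 1) <= 2|Q|. *)
Require Import Defs.
From HB Require Import structures.
From mathcomp Require Import all_boot all_order all_algebra.
From mathcomp Require Import complex.
From mathcomp Require Import all_classical all_reals all_analysis.
From mathcomp Require Import ring lra.

Set Implicit Arguments.
Unset Strict Implicit.
Unset Printing Implicit Defensive.

Import Order.TTheory GRing.Theory Num.Theory.
Import numFieldNormedType.Exports.

Local Open Scope classical_set_scope.
Local Open Scope ring_scope.
Local Open Scope complex_scope.

(** * Real-valued norms and limits *)

Section RealNorm.
Context {R : realType} {V : normedModType R[i]}.
Implicit Types x y : V.

Definition rnorm x : R := complex.Re `|x|.

Lemma normE x : `|x| = (rnorm x)%:C.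
Proof. by rewrite /rnorm RRe_real// ger0_real. Qed.

Lemma rnorm_ge0 x : 0 <= rnorm x.
Proof. by rewrite -ler0c -normE. Qed.

Lemma rnorm0 : rnorm 0 = 0.
Proof. by rewrite /rnorm normr0. Qed.

Lemma rnorm0_eq0 x : rnorm x = 0 -> x = 0.
Proof. by move=> x0; apply/normr0_eq0; rewrite normE x0. Qed.

Lemma ler_rnormD x y : rnorm (x + y) <= rnorm x + rnorm y.
Proof.
have := ler_normD x y; rewrite !normE.
by rewrite -[X in _ <= X -> _]rmorphD lecR.
Qed.

Lemma rnormN x : rnorm (- x) = rnorm x.
Proof. by rewrite /rnorm normrN. Qed.

Lemma ler_rnormB x y : rnorm (x - y) <= rnorm x + rnorm y.
Proof. by rewrite -[rnorm y]rnormN ler_rnormD. Qed.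

Lemma rnormZ (k : R[i]) x : rnorm (k *: x) = complex.Re `|k| * rnorm x.
Proof.
by rewrite /rnorm normrZ (normE x) normc_def /= mul0r subr0.
Qed.

Lemma rnormZr (r : R) x : rnorm (r%:C *: x) = `|r| * rnorm x.
Proof. by rewrite rnormZ normc_def /= expr0n addr0 sqrtr_sqr. Qed.

Lemma rnormZi x : rnorm ('i *: x) = rnorm x.
Proof. by rewrite rnormZ normc_def /= expr0n add0r expr1n sqrtr1 mul1r. Qed.

End RealNorm.

Section Limits.
Context {R : realType}.

Lemma inv_succ_small (K e : R) : 0 < e -> exists n, K / n.+1%:R < e.
Proof.
move=> e0; have [n Kn] : exists n, K / e < n.+1%:R.
  exists (Num.truncn (K / e)); exact: truncnS_gt.
by exists n; rewrite ltr_pdivrMr// mulrC -ltr_pdivrMr.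
Qed.

Lemma le0_inv_succ (z K : R) : (forall n, z <= K / n.+1%:R) -> z <= 0.
Proof.
move=> zK; rewrite leNgt; apply/negP => /(@inv_succ_small K)[n].
by rewrite ltNge zK.
Qed.

(** An explicit rate makes [u] Cauchy, and the same rate survives in the limit up to an arbitrary
    [e]. All limits of operators below are taken pointwise through this form of completeness. *)
Lemma rnorm_lim (V : completeNormedModType R[i]) (u : nat -> V) (K : R) :
  (forall n m, (n <= m)%N -> rnorm (u m - u n) <= K / n.+1%:R) ->
  exists l, forall n, rnorm (l - u n) <= K / n.+1%:R.
Proof.
move=> uK.
have K0 : 0 <= K.
  by have := uK _ _ (leqnn 0); rewrite subrr rnorm0 divr1.
have cu : cvgn u.
  apply/cauchy_cvgP/cauchy_exP => e e0.
  have [|n Kn] := @inv_succ_small K (complex.Re e).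
    by move: e0; rewrite ltcE /= => /andP[].
  exists (u n); exists n => // m /= nm; rewrite /ball_ /= -ball_normE /ball_ /=.
  rewrite distrC normE ltcE /=; apply/andP; split.
    by move: e0; rewrite ltcE /= => /andP[/eqP ->].
  exact: le_lt_trans (uK _ _ nm) Kn.
exists (limn u) => n; apply/ler_addgt0Pr => e e0.
have /cvgrPdist_lt/(_ e%:C) : u @ \oo --> limn u by [].
rewrite ltcR => /(_ e0) [N _ /(_ (maxn n N))] /=.
rewrite leq_maxr => /(_ isT); rewrite normE ltcR => lt_e.
have -> : limn u - u n = (limn u - u (maxn n N)) + (u (maxn n N) - u n).
  by rewrite addrA subrK.
rewrite (le_trans (ler_rnormD _ _))// addrC lerD ?uK ?leq_maxl//.
exact: ltW.
Qed.

End Limits.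

(** * The ring of adjointable operators *)

Section InnerProduct.
Context {R : realType} {A : cstarAlgType R} {H : innerProdModType A}.
Implicit Types (x y z : H).

Lemma inner0r x : inner x 0 = 0 :> A.
Proof. by rewrite -[0 in LHS](scale0r 0) innerZr scale0r. Qed.

Lemma inner0l x : inner 0 x = 0 :> A.
Proof. by rewrite -[0 in LHS](scale0r 0) innerZl rmorph0 scale0r. Qed.

Lemma innerNr x y : inner x (- y) = - inner x y :> A.
Proof. by rewrite -scaleN1r innerZr scaleN1r. Qed.

Lemma innerNl x y : inner (- x) y = - inner x y :> A.
Proof. by rewrite -scaleN1r innerZl rmorphN1 scaleN1r. Qed.

Lemma innerBr x y z : inner x (y - z) = inner x y - inner x z :> A.
Proof. by rewrite innerDr innerNr. Qed.

Lemma innerBl x y z : inner (x - y) z = inner x z - inner y z :> A.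
Proof. by rewrite innerDl innerNl. Qed.

Lemma inner_injr x y : (forall z, inner z x = inner z y :> A) -> x = y.
Proof.
by move=> xy; apply: inner_injl => z; rewrite -star_inner xy star_inner.
Qed.

End InnerProduct.

Section AdjointableRing.
Context {R : realType} {A : cstarAlgType R} {H : innerProdModType A}.
Implicit Types X Y Z : 'L(H).

Lemma adjOp_ext X Y : (forall x, X x = Y x) -> X = Y.
Proof.
move: X Y => [X PX] [Y PY] /= /funext XY; rewrite -XY in PY *.
by congr AdjOp; exact: Prop_irrelevance.
Qed.

Lemma adjOp_adjE X x y : inner (X x) y = inner x (adjOp_adj X y) :> A.
Proof.
have [S XS] := adjOpP X.
exact: (xgetI _ XS : is_adjoint X (adjoint X)).
Qed.

Lemma adjOp_adjEr X x y : inner x (X y) = inner (adjOp_adj X x) y :> A.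
Proof. by rewrite -star_inner adjOp_adjE star_inner. Qed.

Lemma adjOp_adj_unique X Y :
  (forall x y, inner (X x) y = inner x (Y y) :> A) -> adjOp_adj X = Y.
Proof.
move=> XY; apply: adjOp_ext => y; apply: inner_injr => z.
by rewrite -adjOp_adjE XY.
Qed.

Lemma adjOp_is_linear (X : 'L(H)) : linear X.
Proof. by move=> k x y; rewrite adjOpD adjOpZ. Qed.

HB.instance Definition _ X := GRing.isLinear.Build R[i] H H _ X
  (adjOp_is_linear X).

Lemma adjOp_zero_subproof : @adjointable R A H H (fun=> 0).
Proof. by exists (fun=> 0) => x y; rewrite inner0l inner0r. Qed.

Lemma adjOp_one_subproof : @adjointable R A H H (fun x => x).
Proof. by exists id. Qed.

Lemma adjOp_add_subproof X Y : @adjointable R A H H (fun x => X x + Y x).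
Proof.
exists (fun x => adjOp_adj X x + adjOp_adj Y x) => x y.
by rewrite innerDl innerDr !adjOp_adjE.
Qed.

Lemma adjOp_scale_subproof (k : R[i]) X :
  @adjointable R A H H (fun x => k *: X x).
Proof.
exists (fun x => k^* *: adjOp_adj X x) => x y.
by rewrite innerZl innerZr adjOp_adjE.
Qed.

Lemma adjOp_opp_subproof X : @adjointable R A H H (fun x => - X x).
Proof.
exists (fun x => - adjOp_adj X x) => x y.
by rewrite innerNl innerNr adjOp_adjE.
Qed.

Lemma adjOp_mul_subproof X Y : @adjointable R A H H (fun x => X (Y x)).
Proof.
by exists (fun x => adjOp_adj Y (adjOp_adj X x)) => x y; rewrite !adjOp_adjE.
Qed.

HB.instance Definition _ := gen_eqMixin 'L(H).
HB.instance Definition _ := gen_choiceMixin 'L(H).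

Program Definition adjOp_isZmodule := GRing.isZmodule.Build 'L(H)
  (zero := AdjOp adjOp_zero_subproof)
  (opp := fun X => AdjOp (adjOp_opp_subproof X))
  (add := fun X Y => AdjOp (adjOp_add_subproof X Y)) _ _ _ _.
Next Obligation. by move=> X Y Z; apply: adjOp_ext => x /=; rewrite addrA. Qed.
Next Obligation. by move=> X Y; apply: adjOp_ext => x /=; rewrite addrC. Qed.
Next Obligation. by move=> X; apply: adjOp_ext => x /=; rewrite add0r. Qed.
Next Obligation. by move=> X; apply: adjOp_ext => x /=; rewrite addNr. Qed.

HB.instance Definition _ := adjOp_isZmodule.

(** Only a possibly trivial ring is obtained, since [1 = 0] when [H] is the zero module. *)
Program Definition adjOp_isPzRing := GRing.Zmodule_isPzRing.Build 'L(H)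
  (one := AdjOp adjOp_one_subproof)
  (mul := fun X Y => AdjOp (adjOp_mul_subproof X Y)) _ _ _ _ _.
Next Obligation. by move=> X Y Z; apply: adjOp_ext. Qed.
Next Obligation. by move=> X; apply: adjOp_ext. Qed.
Next Obligation. by move=> X; apply: adjOp_ext. Qed.
Next Obligation. by move=> X Y Z; apply: adjOp_ext. Qed.
Next Obligation.
by move=> X Y Z; apply: adjOp_ext => x /=; rewrite raddfD.
Qed.

HB.instance Definition _ := adjOp_isPzRing.

Program Definition adjOp_isLmodule := GRing.Zmodule_isLmodule.Build R[i] 'L(H)
  (scale := fun k X => AdjOp (adjOp_scale_subproof k X)) _ _ _ _.
Next Obligation.
by move=> k l X; apply: adjOp_ext => x /=; rewrite scalerA.
Qed.
Next Obligation. by move=> X; apply: adjOp_ext => x /=; rewrite scale1r. Qed.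
Next Obligation.
by move=> k X Y; apply: adjOp_ext => x /=; rewrite scalerDr.
Qed.
Next Obligation.
by move=> X k l; apply: adjOp_ext => x /=; rewrite scalerDl.
Qed.

HB.instance Definition _ := adjOp_isLmodule.

Lemma add_adjOpE X Y x : (X + Y) x = X x + Y x. Proof. by []. Qed.
Lemma opp_adjOpE X x : (- X) x = - X x. Proof. by []. Qed.
Lemma mul_adjOpE X Y x : (X * Y) x = X (Y x). Proof. by []. Qed.
Lemma scale_adjOpE (k : R[i]) X x : (k *: X) x = k *: X x. Proof. by []. Qed.
Lemma one_adjOpE x : (1 : 'L(H)) x = x. Proof. by []. Qed.
Lemma zero_adjOpE x : (0 : 'L(H)) x = 0. Proof. by []. Qed.

Definition adjOpE := (add_adjOpE, opp_adjOpE, mul_adjOpE, scale_adjOpE,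
  one_adjOpE, zero_adjOpE).

Lemma adjOp_scaleAl (k : R[i]) X Y : k *: (X * Y) = (k *: X) * Y.
Proof. exact: adjOp_ext. Qed.

Lemma adjOp_scaleAr (k : R[i]) X Y : k *: (X * Y) = X * (k *: Y).
Proof. by apply: adjOp_ext => x; rewrite !adjOpE linearZ. Qed.


Local Notation "X ^†" := (adjOp_adj X) (at level 2, format "X ^†").

Lemma dagK X : X^†^† = X.
Proof. by apply: adjOp_adj_unique => x y; rewrite -adjOp_adjEr. Qed.

Lemma dag0 : (0 : 'L(H))^† = 0.
Proof. by apply: adjOp_adj_unique => x y; rewrite inner0l inner0r. Qed.

Lemma dag1 : (1 : 'L(H))^† = 1.
Proof. exact: adjOp_adj_unique. Qed.

Lemma dagD X Y : (X + Y)^† = X^† + Y^†.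
Proof.
by apply: adjOp_adj_unique => x y; rewrite !adjOpE innerDl innerDr !adjOp_adjE.
Qed.

Lemma dagN X : (- X)^† = - X^†.
Proof.
by apply: adjOp_adj_unique => x y; rewrite !adjOpE innerNl innerNr !adjOp_adjE.
Qed.

Lemma dagB X Y : (X - Y)^† = X^† - Y^†.
Proof. by rewrite dagD dagN. Qed.

Lemma dagM X Y : (X * Y)^† = Y^† * X^†.
Proof. by apply: adjOp_adj_unique => x y; rewrite !adjOpE !adjOp_adjE. Qed.

Lemma dagZ (k : R[i]) X : (k *: X)^† = k^* *: X^†.
Proof.
by apply: adjOp_adj_unique => x y; rewrite !adjOpE innerZl innerZr adjOp_adjE.
Qed.

Lemma dagZr (r : R) X : (r%:C *: X)^† = r%:C *: X^†.
Proof. by rewrite dagZ conj_Creal//; apply/complex_realP; exists r. Qed.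

Lemma dagZi X : ('i *: X)^† = - ('i *: X^†).
Proof. rewrite dagZ -scaleNr; congr (_ *: _).
by apply/eqP; rewrite eq_complex /= oppr0 !eqxx. Qed.

Lemma dagX X n : (X ^+ n)^† = X^† ^+ n.
Proof.
by elim: n => [|n IHn]; rewrite ?expr0 ?dag1// exprS dagM IHn -exprSr.
Qed.

End AdjointableRing.

Notation "X ^†" := (adjOp_adj X) (at level 2, format "X ^†").

(** * Bounded operators *)

Section CStarNorm.
Context {R : realType} {A : cstarAlgType R}.
Implicit Types a b : A.

Lemma rnorm_smul a b : rnorm (smul a b) <= rnorm a * rnorm b.
Proof. by have := norm_smul a b; rewrite !normE -rmorphM lecR. Qed.

Lemma rnorm_cstar a : rnorm (smul (star a) a) = rnorm a ^+ 2.
Proof. by apply: complexI; rewrite rmorphXn /= -!normE norm_cstar. Qed.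

(** The $C^*$-identity gives $|b|^2 = |b^* b| \le |b^*| |b|$; cancel $|b|$, then exchange $b$ and
    $b^*$. *)
Lemma rnorm_star a : rnorm (star a) = rnorm a.
Proof.
suff le_star b : rnorm b <= rnorm (star b).
  by apply/eqP; rewrite eq_le -{2}(starK a) !le_star.
have [->|b0] := eqVneq (rnorm b) 0; first exact: rnorm_ge0.
have b_gt0 : 0 < rnorm b by rewrite lt_def b0 rnorm_ge0.
by rewrite -(ler_pM2r b_gt0) -expr2 -rnorm_cstar rnorm_smul.
Qed.

End CStarNorm.

Section HilbertNorm.
Context {R : realType} {A : cstarAlgType R} {H : hilbertModType A}.
Implicit Types (x y v : H) (X Y : 'L(H)).

Local Notation "⟨ x , y ⟩" := (inner x y : A) (format "⟨ x ,  y ⟩").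

Lemma scaleii (V : lmodType R[i]) (x : V) : 'i *: ('i *: x) = - x.
Proof. by rewrite scalerA -expr2 sqr_i scaleN1r. Qed.

Lemma rnorm_inner x : rnorm x ^+ 2 = rnorm ⟨x, x⟩.
Proof. by apply: complexI; rewrite rmorphXn /= -!normE norm_inner. Qed.

Lemma rnorm_ract x (a : A) : rnorm (ract x a) <= rnorm x * rnorm a.
Proof.
rewrite -(@ler_pXn2r _ 2)// ?nnegrE ?mulr_ge0 ?rnorm_ge0//.
rewrite rnorm_inner inner_ract inner_ractl -smulA.
have := rnorm_smul (star a) (smul ⟨x, x⟩ a).
have := ler_wpM2l (rnorm_ge0 a) (rnorm_smul ⟨x, x⟩ a).
rewrite rnorm_star -rnorm_inner => le1 le2; apply: (le_trans le2).
apply: (le_trans le1); rewrite le_eqVlt; apply/orP; left; apply/eqP; ring.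
Qed.

Lemma innerZil x y : inner ('i *: x) y = - ('i *: inner x y) :> A.
Proof.
rewrite innerZl -scaleNr; congr (_ *: _).
by apply/eqP; rewrite eq_complex /= oppr0 !eqxx.
Qed.

Lemma sum4_sub (V : zmodType) (a b c d : V) :
  a + b + (c + d) - (a - b + (- c + d)) = (b + c) *+ 2.
Proof.
have -> : a + b + (c + d) = (a + d) + (b + c).
  by rewrite [RHS]addrACA [d + _]addrC.
have -> : a - b + (- c + d) = (a + d) - (b + c).
  by rewrite opprD [RHS]addrACA [d + _]addrC.
by rewrite opprB addrC addrA subrK mulr2n.
Qed.

Lemma inner_parallelogram x y :
  ⟨x + y, x + y⟩ - ⟨x - y, x - y⟩ = (⟨x, y⟩ + ⟨y, x⟩) *+ 2.
Proof.
rewrite !(innerDl, innerDr, innerNl, innerNr) opprK.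
exact: sum4_sub.
Qed.

Lemma rnorm_mulr2n (V : normedModType R[i]) (x : V) :
  rnorm (x *+ 2) = 2 * rnorm x.
Proof.
by rewrite /rnorm normrMn mulr2n mulr_natl mulr2n; case: `|x|.
Qed.

(** Polarization bounds $\langle x, y\rangle + \langle y, x\rangle$ by norms in [H]; replacing $y$
    by $iy$ bounds the difference of the two terms as well. *)
Lemma ler_rnorm_inner_sqrD x y : rnorm ⟨x, y⟩ <= (rnorm x + rnorm y) ^+ 2.
Proof.
have re_le z : rnorm (⟨x, z⟩ + ⟨z, x⟩) <= (rnorm x + rnorm z) ^+ 2.
  have := ler_rnormB ⟨x + z, x + z⟩ ⟨x - z, x - z⟩.
  rewrite inner_parallelogram rnorm_mulr2n -!rnorm_inner => le_sq.
  have := ler_rnormD x z; have := ler_rnormB x z.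
  have := rnorm_ge0 (x + z); have := rnorm_ge0 (x - z).
  by nra.
have := re_le y; have := re_le ('i *: y).
rewrite innerZr innerZil rnormZi -scalerBr rnormZi => im_le re_le'.
have := ler_rnormD (⟨x, y⟩ + ⟨y, x⟩) (⟨x, y⟩ - ⟨y, x⟩).
rewrite addrACA subrr addr0 -mulr2n rnorm_mulr2n; lra.
Qed.

(** A weak Cauchy-Schwarz inequality, by normalizing both vectors: the constant is $(1 + 1)^2$. It
    suffices for limits of operators, and the sharp inequality is later bootstrapped from it. *)
Lemma ler_rnorm_inner4 x y : rnorm ⟨x, y⟩ <= 4 * (rnorm x * rnorm y).
Proof.
have [/rnorm0_eq0 ->|x0] := eqVneq (rnorm x) 0.
  by rewrite inner0l !rnorm0 mul0r mulr0.
have [/rnorm0_eq0 ->|y0] := eqVneq (rnorm y) 0.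
  by rewrite inner0r !rnorm0 !mulr0.
have := ler_rnorm_inner_sqrD ((rnorm x)^-1%:C *: x) ((rnorm y)^-1%:C *: y).
rewrite !rnormZr innerZr rnormZr innerZl.
rewrite conj_Creal; last by apply/complex_realP; exists (rnorm x)^-1.
rewrite rnormZr !ger0_norm ?invr_ge0 ?rnorm_ge0// !mulVf//.
have p0 : 0 < rnorm x by rewrite lt_def x0 rnorm_ge0.
have q0 : 0 < rnorm y by rewrite lt_def y0 rnorm_ge0.
rewrite [_^-1 * _]mulrC ler_pdivrMr// [_^-1 * _]mulrC ler_pdivrMr//.
move=> le4; suff -> : 4 * (rnorm x * rnorm y) =
  (1 + 1) ^+ 2 * rnorm y * rnorm x by [].
by ring.
Qed.

(** On the zero module a negative [t] is also a bound, whence the explicit sign hypotheses in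
    several lemmas. *)
Definition bounded_by X (t : R) := forall v, rnorm (X v) <= t * rnorm v.

Lemma bounded_by_ge0 X t v : bounded_by X t -> 0 <= t * rnorm v.
Proof. by move=> Xt; exact: le_trans (rnorm_ge0 _) (Xt v). Qed.

Lemma bounded_byW X s t : s <= t -> bounded_by X s -> bounded_by X t.
Proof. by move=> st Xs v; rewrite (le_trans (Xs v))// ler_wpM2r ?rnorm_ge0. Qed.

Lemma bounded_by0 : bounded_by 0 0.
Proof. by move=> v; rewrite rnorm0 mul0r. Qed.

Lemma bounded_by1 : bounded_by 1 1.
Proof. by move=> v; rewrite mul1r. Qed.

Lemma bounded_byN X t : bounded_by X t -> bounded_by (- X) t.
Proof. by move=> Xt v; rewrite adjOpE rnormN. Qed.

Lemma bounded_byD X Y s t :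
  bounded_by X s -> bounded_by Y t -> bounded_by (X + Y) (s + t).
Proof.
by move=> Xs Yt v; rewrite adjOpE (le_trans (ler_rnormD _ _))// mulrDl lerD.
Qed.

Lemma bounded_byB X Y s t :
  bounded_by X s -> bounded_by Y t -> bounded_by (X - Y) (s + t).
Proof. by move=> Xs Yt; apply/bounded_byD/bounded_byN. Qed.

Lemma bounded_byZr (r : R) X t :
  0 <= r -> bounded_by X t -> bounded_by (r%:C *: X) (r * t).
Proof.
by move=> r0 Xt v; rewrite adjOpE rnormZr ger0_norm// -mulrA ler_wpM2l.
Qed.

Lemma bounded_byZi X t : bounded_by X t -> bounded_by ('i *: X) t.
Proof. by move=> Xt v; rewrite adjOpE rnormZi. Qed.

Lemma bounded_byM X Y s t : 0 <= s ->
  bounded_by X s -> bounded_by Y t -> bounded_by (X * Y) (s * t).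
Proof.
by move=> s0 Xs Yt v; rewrite adjOpE (le_trans (Xs _))// -mulrA ler_wpM2l.
Qed.

Lemma bounded_byX X t n :
  0 <= t -> bounded_by X t -> bounded_by (X ^+ n) (t ^+ n).
Proof.
move=> t0 Xt; elim: n => [|n IHn]; first exact: bounded_by1.
by rewrite !exprS; exact: bounded_byM.
Qed.

(* For commuting self-adjoint operators, [X v] is the mean of [(X + iY) v] and
   [(X - iY) v], which have the same norm: this replaces, throughout, the
   comparison of [X^2] with [X^2 + Y^2] in the order of operators. *)
Lemma rnorm_le_sum_squares X Y v : X^† = X -> Y^† = Y -> X * Y = Y * X ->
  rnorm (X v) ^+ 2 <= rnorm ⟨v, (X ^+ 2 + Y ^+ 2) v⟩.
Proof.
move=> Xs Ys XY.
(* The adjoint of $X + iZ$ is $X - iZ$, and in their product the cross terms cancel by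
   commutation. *)
have XiY Z : Z^† = Z -> X * Z = Z * X ->
    rnorm ((X + 'i *: Z) v) ^+ 2 = rnorm ⟨v, (X ^+ 2 + Z ^+ 2) v⟩.
  move=> Zs XZ; rewrite rnorm_inner adjOp_adjE -mul_adjOpE.
  rewrite dagD dagZi Xs Zs; congr (rnorm (inner _ (adjOp_fun _ _))).
  rewrite mulrDl !mulrDr !mulNr -!adjOp_scaleAl -!adjOp_scaleAr scaleii.
  by rewrite opprK XZ addrACA addrA subrK.
set p := rnorm _.
have := XiY (- Y); rewrite dagN Ys mulrN mulNr XY => /(_ erefl erefl).
have := XiY Y Ys XY; rewrite sqrrN scalerN.
set q := rnorm ⟨_, _⟩; set a := rnorm (_ _); set b := rnorm (_ _) => aq bq.
have pab : 2 * p <= a + b.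
  rewrite /p -rnorm_mulr2n mulr2n.
  have -> : X v + X v = (X + 'i *: Y) v + (X - 'i *: Y) v.
    by rewrite !adjOpE addrACA subrr addr0.
  exact: ler_rnormD.
have p0 : 0 <= p by exact: rnorm_ge0.
have a0 : 0 <= a by exact: rnorm_ge0.
have b0 : 0 <= b by exact: rnorm_ge0.
have := sqr_ge0 (a - b); rewrite sqrrB.
have : (2 * p) ^+ 2 <= (a + b) ^+ 2.
  by rewrite lerXn2r ?nnegrE ?addr_ge0 ?mulr_ge0.
by rewrite sqrrD aq bq; lra.
Qed.

End HilbertNorm.

(** * Square roots *)

Section OperatorLimits.
Context {R : realType} {A : cstarAlgType R} {H : hilbertModType A}.
Implicit Types (v : H) (X Y Z : 'L(H)).

Lemma adjOp_eq_lim X Y (K : R) :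
  (forall n, bounded_by (X - Y) (K / n.+1%:R)) -> X = Y.
Proof.
move=> XYK; apply: adjOp_ext => v; apply: subr0_eq; apply: rnorm0_eq0.
apply/eqP; rewrite eq_le rnorm_ge0 andbT.
by apply: (@le0_inv_succ _ _ (K * rnorm v)) => n; rewrite mulrAC; exact: XYK.
Qed.

Lemma bounded_by_lim X (c K : R) :
  (forall n, bounded_by X (c + K / n.+1%:R)) -> bounded_by X c.
Proof.
move=> XcK v; rewrite -subr_le0.
apply: (@le0_inv_succ _ _ (K * rnorm v)) => n.
by rewrite lerBlDl mulrAC -mulrDl; exact: XcK.
Qed.

(** The pointwise limit [f] is its own adjoint because each [y n] is; adjointability then brings
    linearity with it. *)
Lemma adjOp_lim (y : nat -> 'L(H)) (K : R) : 0 <= K ->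
  (forall n, (y n)^† = y n) ->
  (forall n m, (n <= m)%N -> bounded_by (y m - y n) (K / n.+1%:R)) ->
  exists2 Y, Y^† = Y & forall n, bounded_by (Y - y n) (K / n.+1%:R).
Proof.
move=> K0 ys yK.
have /choice[f fy] : forall v, exists l, forall n,
    rnorm (l - y n v) <= K * rnorm v / n.+1%:R.
  by move=> v; apply: rnorm_lim => n m nm; rewrite mulrAC; exact: yK.
have fs : @is_adjoint _ _ H H f f.
  move=> u v; apply: subr0_eq; apply: rnorm0_eq0; apply/eqP.
  rewrite eq_le rnorm_ge0 andbT.
  (* Two error terms, each with the constant 4 of [ler_rnorm_inner4]. *)
  apply: (@le0_inv_succ _ _ (8 * K * rnorm u * rnorm v)) => n.
  have -> : inner (f u) v - inner u (f v) =
      inner (f u - y n u) v - inner u (f v - y n v) :> A.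
    by rewrite innerBl innerBr adjOp_adjE ys opprB addrA subrK.
  have n0 : 0 <= n.+1%:R^-1 :> R by rewrite invr_ge0.
  have u0 := rnorm_ge0 u; have v0 := rnorm_ge0 v.
  apply: (le_trans (ler_rnormB _ _)).
  have := ler_rnorm_inner4 (f u - y n u) v.
  have := ler_rnorm_inner4 u (f v - y n v).
  have := ler_wpM2r v0 (fy u n); have := ler_wpM2l u0 (fy v n).
  move: (rnorm (f u - y n u)) (rnorm (f v - y n v)) => a b.
  by move: (n.+1%:R^-1) => e; lra.
exists (AdjOp (ex_intro _ f fs)); first exact: adjOp_adj_unique.
by move=> n v; rewrite adjOpE /= mulrAC; exact: fy.
Qed.

End OperatorLimits.

Section ScalarIteration.
Context {R : realType}.

Lemma realC_half_mul2 : 2%:R * (2^-1)%:C = 1 :> R[i].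
Proof.
have -> : 2%:R = 2%:R%:C :> R[i] by rewrite raddfMn.
by rewrite -rmorphM /= divff.
Qed.

(** The operator iteration below with [X] replaced by the scalar 1. It increases to 1 and majorizes
    the operator iterates. *)
Fixpoint sqrt_iter (n : nat) : R :=
  if n is m.+1 then 2^-1 * (1 + sqrt_iter m ^+ 2) else 0.

Lemma sqrt_iter_itv n : 0 <= sqrt_iter n <= 1.
Proof. by elim: n => [|n /andP[a0 a1]] /=; rewrite ?lexx//; nra. Qed.

(** The gap $d = 1 - a$ evolves by $d' = d - d^2/2$, hence decays like $2/n$. *)
Lemma sqrt_iter_gap n : 1 - sqrt_iter n <= 2 / n.+1%:R.
Proof.
rewrite ler_pdivlMr//; elim: n => [|n] /=; first by lra.
have /andP[a0 a1] := sqrt_iter_itv n.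
rewrite -[n.+2%:R]natr1; have : 1 <= n.+1%:R :> R by rewrite ler1n.
by move: (sqrt_iter n) (n.+1%:R) a0 a1 => a m a0 a1 m1 gap; nra.
Qed.

End ScalarIteration.

Section SquareRoot.
Context {R : realType} {A : cstarAlgType R} {H : hilbertModType A}.
Variable X : 'L(H).
Implicit Types (v : H) (Y Z : 'L(H)).

(* Bounding all the [X^j (Z v)] at once, and not just [Z v], makes the bounds
   multiplicative although [X] is only assumed to be power-bounded. *)
Let dominated Z (t : R) := forall (M : R) v,
  (forall j, rnorm ((X ^+ j) v) <= M) ->
  forall j, rnorm ((X ^+ j) (Z v)) <= t * M.

Let dominatedD Y Z s t :
  dominated Y s -> dominated Z t -> dominated (Y + Z) (s + t).
Proof.
move=> Ys Zt M v vM j; rewrite adjOpE raddfD (le_trans (ler_rnormD _ _))//.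
by rewrite mulrDl lerD ?Ys ?Zt.
Qed.

Let dominatedM Y Z s t :
  dominated Y s -> dominated Z t -> dominated (Y * Z) (s * t).
Proof.
by move=> Ys Zt M v vM j; rewrite adjOpE -mulrA Ys// => k; rewrite Zt.
Qed.

Let dominatedZ Z (r t : R) :
  0 <= r -> dominated Z t -> dominated (r%:C *: Z) (r * t).
Proof.
move=> r0 Zt M v vM j; rewrite adjOpE linearZ /= rnormZr ger0_norm// -mulrA.
by rewrite ler_wpM2l ?Zt.
Qed.

(** A limit $Y$ satisfies $2Y = X + Y^2$, that is $(1 - Y)^2 = 1 - X$. *)
Let y := fix y n : 'L(H) :=
  if n is m.+1 then (2^-1)%:C *: (X + y m ^+ 2) else 0.

Let y_commute Y : X * Y = Y * X -> forall n, y n * Y = Y * y n.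
Proof.
move=> XY; elim=> [|n IHn] /=; first by rewrite mul0r mulr0.
rewrite -adjOp_scaleAl -adjOp_scaleAr mulrDl mulrDr XY.
by rewrite !expr2 -mulrA IHn !mulrA IHn.
Qed.

Let y_commute_y n m : y n * y m = y m * y n.
Proof. by apply/y_commute/esym/y_commute. Qed.

Let y_dominated n : dominated (y n) (sqrt_iter n).
Proof.
elim: n => [|n IHn] /=; first by move=> M v vM j; rewrite raddf0 rnorm0 mul0r.
apply: dominatedZ; first by rewrite invr_ge0.
apply: dominatedD; last exact: dominatedM.
(* Applying [X] only shifts the sequence of the [(X ^+ j) v], so [X] is dominated by 1 even when its
   norm is larger. *)
by move=> M v vM j; rewrite mul1r -mul_adjOpE -exprSr.
Qed.

(** The iterates commute, so differences of squares factor: $y_{n+2} - y_{n+1} = (y_{n+1} +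
    y_n)(y_{n+1} - y_n)/2$, and the scalar iteration obeys the same recursion. *)
Let y_step n : dominated (y n.+1 - y n) (sqrt_iter n.+1 - sqrt_iter n).
Proof.
elim: n => [|n IHn].
  by rewrite [y 0]/= [sqrt_iter 0]/= !subr0; exact: y_dominated.
have yS m : y m.+1 = (2^-1)%:C *: (X + y m ^+ 2) by [].
have aS m : sqrt_iter m.+1 = 2^-1 * (1 + sqrt_iter m ^+ 2) :> R by [].
rewrite (yS n.+1) {2}(yS n) -scalerBr opprD addrACA subrr add0r.
rewrite (aS n.+1) {2}(aS n) -mulrBr opprD addrACA subrr add0r.
apply: dominatedZ; first by rewrite invr_ge0.
have -> : y n.+1 ^+ 2 - y n ^+ 2 = (y n.+1 + y n) * (y n.+1 - y n).
  by rewrite mulrDl !mulrBr (y_commute_y n n.+1) addrA subrK.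
rewrite subr_sqr mulrC.
by apply: dominatedM => //; apply: dominatedD; exact: y_dominated.
Qed.

Let y_dist n m :
  (n <= m)%N -> dominated (y m - y n) (sqrt_iter m - sqrt_iter n).
Proof.
elim: m => [|m IHm].
  rewrite leqn0 => /eqP ->; rewrite !subrr.
  by move=> M v vM j; rewrite raddf0 rnorm0 mul0r.
rewrite leq_eqVlt => /predU1P[->|nm].
  by rewrite !subrr => M v vM j; rewrite raddf0 rnorm0 mul0r.
have -> : y m.+1 - y n = (y m.+1 - y m) + (y m - y n) by rewrite addrA subrK.
have -> : sqrt_iter m.+1 - sqrt_iter n =
    (sqrt_iter m.+1 - sqrt_iter m) + (sqrt_iter m - sqrt_iter n) :> R.
  by rewrite addrA subrK.
by apply: dominatedD; [exact: y_step | exact: IHm].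
Qed.

Lemma adjOp_sqrt_1B (c : R) : 0 <= c -> X^† = X ->
  (forall j, bounded_by (X ^+ j) c) ->
  exists S : 'L(H), [/\ S^† = S, S ^+ 2 = 1 - X, bounded_by (1 - S) c &
    forall Y t, 0 <= t -> bounded_by Y t -> X * Y = Y * X -> S * Y = Y * S].
Proof.
move=> c0 Xs Xc.
have domP Z t : dominated Z t -> bounded_by Z (t * c).
  by move=> Zt v; rewrite -mulrA; apply: (Zt _ _ _ 0) => j; exact: Xc.
have ys n : (y n)^† = y n.
  elim: n => [|n IHn] /=; first exact: dag0.
  by rewrite dagZr dagD Xs dagX IHn.
have yc n : bounded_by (y n) c.
  apply: bounded_byW (domP _ _ (@y_dominated n)).
  by rewrite ler_piMl//; case/andP: (@sqrt_iter_itv R n).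
have yK n m : (n <= m)%N -> bounded_by (y m - y n) (2 * c / n.+1%:R).
  move=> nm; apply: bounded_byW (domP _ _ (y_dist nm)).
  rewrite mulrAC ler_wpM2r//; apply: le_trans (@sqrt_iter_gap R n).
  by rewrite lerB//; case/andP: (@sqrt_iter_itv R m).
have [|Y Ys YK] := adjOp_lim _ ys yK; first by rewrite mulr_ge0.
(* A crude bound, from [y 0] and the rate at 0, used to control error terms; the bound [c] is
   reached below in the limit. *)
have Yc : bounded_by Y (3 * c).
  rewrite -[Y](subrK (y 0)); apply: bounded_byW (bounded_byD (YK 0) (yc 0)).
  by rewrite divr1; lra.
have c3 : 0 <= 3 * c by rewrite mulr_ge0.
exists (1 - Y); split.
- by rewrite dagB dag1 Ys.
- suff YX : Y *+ 2 - Y ^+ 2 = X.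
    by rewrite -sqrrN opprB sqrrB1 -YX opprB [RHS]addrC.
  (* The summands bound, in this order, $2(Y - y_{n+1})$, $Y (Y - y_n)$ with $|Y| \le 3c$, and $(Y -
     y_n) y_n$ with $|y_n| \le c$. *)
  apply: (@adjOp_eq_lim _ _ _ _ _ (4 * c + (6 * c * c + 2 * c * c))) => n.
  have -> : Y *+ 2 - Y ^+ 2 - X = (Y - y n.+1) *+ 2 -
      (Y * (Y - y n) + (Y - y n) * y n).
    have y2 : y n.+1 *+ 2 = X + y n ^+ 2.
      by rewrite -scaler_nat scalerA realC_half_mul2 scale1r.
    have -> : X = y n.+1 *+ 2 - y n ^+ 2 by rewrite y2 addrK.
    rewrite mulrnBl mulrBr mulrBl addrA subrK -!expr2.
    by rewrite !opprD !opprK addrACA.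
  rewrite [Z in bounded_by _ Z]mulrDl; apply: bounded_byB.
    have -> : 4 * c / n.+1%:R = 2 * c / n.+1%:R + 2 * c / n.+1%:R.
      by rewrite -mulrDl; congr (_ / _); ring.
    have Yn2 : bounded_by (Y - y n.+1) (2 * c / n.+1%:R).
      apply: bounded_byW (YK n.+1).
      by rewrite ler_wpM2l ?mulr_ge0// lef_pV2 ?posrE// ler_nat.
    exact: bounded_byD.
  rewrite [Z in bounded_by _ Z]mulrDl; apply: bounded_byD.
    have -> : 6 * c * c / n.+1%:R = 3 * c * (2 * c / n.+1%:R) by ring.
    exact: bounded_byM.
  rewrite -mulrA [c / _]mulrC mulrA.
  by apply: bounded_byM => //; rewrite divr_ge0// mulr_ge0.
- rewrite opprB addrC subrK; apply: (@bounded_by_lim _ _ _ _ _ (2 * c)) => n.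
  rewrite -[Y](subrK (y n)) [_ + y n]addrC.
  exact: bounded_byD.
- move=> Z t t0 Zt XZ; rewrite mulrBl mulrBr mul1r mulr1; congr (_ - _).
  apply: (@adjOp_eq_lim _ _ _ _ _ (2 * c * t + t * (2 * c))) => n.
  have -> : Y * Z - Z * Y = (Y - y n) * Z - Z * (Y - y n).
    by rewrite mulrBl mulrBr (y_commute XZ) opprB addrA subrK.
  have -> : (2 * c * t + t * (2 * c)) / n.+1%:R =
      2 * c / n.+1%:R * t + t * (2 * c / n.+1%:R) by ring.
  by apply: bounded_byB; apply: bounded_byM => //; rewrite divr_ge0// mulr_ge0.
Qed.

End SquareRoot.

(** * The Cauchy-Schwarz inequality *)

Section PowerGrowth.
Context {R : realType}.

(** If $a > t > 0$, Bernoulli's inequality makes $(a/t)^{2m}$ grow at least quadratically in $m =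
    2^k$, against a linear upper bound. *)
Lemma le_power2_growth (a t K : R) : 0 <= a -> 0 <= t ->
  (forall k, a ^+ (2 ^ k) <= K * (2 ^ k).+1%:R * t ^+ (2 ^ k)) -> a <= t.
Proof.
move=> a0 t0 aK; rewrite leNgt; apply/negP => ta.
have [t_eq0|t_neq0] := eqVneq t 0.
  by have := aK 0; rewrite expr1 t_eq0 expr1 mulr0 leNgt -t_eq0 ta.
have t_gt0 : 0 < t by rewrite lt_def t_neq0.
pose d := a / t - 1.
have d0 : 0 < d by rewrite subr_gt0 ltr_pdivlMr// mul1r.
have growth k : (2 ^ k)%:R * d ^+ 2 <= 3 * K.
  have m0 : 0 < (2 ^ k)%:R :> R by rewrite ltr0n expn_gt0.
  have bern : 1 + (2 ^ k)%:R * d <= (a / t) ^+ (2 ^ k).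
    rewrite -[a / t](subrK 1) -/d; elim: (2 ^ k)%N => [|m IHm].
      by rewrite mul0r addr0 expr0.
    have /ler_wpM2r : 0 <= d + 1 by rewrite addr_ge0// ltW.
    move=> /(_ _ _ IHm); rewrite exprSr -natr1 => le_pow.
    apply: le_trans le_pow.
    by have := ler0n R m; move: (m%:R) => r r0; nra.
  (* The next power of two is used, so that the left side is the square of the quantity bounded
     below by [bern]. *)
  have := aK k.+1; rewrite expnS mulnC exprM => aK1.
  have {}aK1 : ((a / t) ^+ (2 ^ k)) ^+ 2 <= K * (2 ^ k * 2).+1%:R.
    by rewrite -exprM expr_div_n ler_pdivrMr ?exprn_gt0// exprM.
  have : (1 + (2 ^ k)%:R * d) ^+ 2 <= ((a / t) ^+ (2 ^ k)) ^+ 2.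
    by rewrite lerXn2r// nnegrE ?(le_trans _ bern)// addr_ge0// mulr_ge0// ltW.
  move=> /le_trans/(_ aK1); rewrite -natr1 natrM => le_m.
  have m1 : 1 <= (2 ^ k)%:R :> R by rewrite ler1n expn_gt0.
  move: ((2 ^ k)%:R) m0 m1 le_m => m m0 m1 le_m.
  have K0 : 0 <= K.
    have : 0 <= K * (m * 2 + 1) by apply: le_trans le_m; exact: sqr_ge0.
    by rewrite pmulr_lge0//; lra.
  rewrite -(ler_pM2r m0); have := mulr_ge0 (ltW m0) (ltW d0).
  by nra.
have [n lt_n] : exists n, 3 * K / d ^+ 2 < n.+1%:R.
  by exists (Num.truncn (3 * K / d ^+ 2)); exact: truncnS_gt.
have := growth n.+1; apply/negP; rewrite -ltNge -ltr_pdivrMr ?exprn_gt0//.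
by apply: lt_le_trans lt_n _; rewrite ler_nat ltnW// ltn_expl.
Qed.

End PowerGrowth.

Section CauchySchwarz.
Context {R : realType} {A : cstarAlgType R} {H : hilbertModType A}.
Implicit Types (x y v : H) (X Y Z : 'L(H)).

Local Notation "⟨ x , y ⟩" := (inner x y : A) (format "⟨ x ,  y ⟩").

(** For $S$ a square root of $1 - X^2$ commuting with $X$, $|Xv|^2 \le |\langle v, (X^2 + S^2)
    v\rangle| = |v|^2$. *)
Lemma power_bounded_contraction X c : 0 <= c -> X^† = X ->
  (forall j, bounded_by (X ^+ j) c) -> bounded_by X 1.
Proof.
move=> c0 Xs Xc.
have [|j|S [Ss S2 _ SX]] := @adjOp_sqrt_1B _ _ _ (X ^+ 2) c c0.
- by rewrite dagX Xs.
- by rewrite -exprM; exact: Xc.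
have XS : X * S = S * X.
  by apply/esym/(SX _ c) => //; [exact: (Xc 1) | rewrite -exprS -exprSr].
move=> v; rewrite mul1r -(@ler_pXn2r _ 2)// ?nnegrE ?rnorm_ge0//.
apply: le_trans (rnorm_le_sum_squares v Xs Ss XS) _.
by rewrite S2 addrC subrK rnorm_inner.
Qed.

Lemma rank1_subproof x : @adjointable _ _ H H (fun v => ract x ⟨x, v⟩).
Proof.
exists (fun v => ract x ⟨x, v⟩) => u v.
by rewrite inner_ractl inner_ract star_inner.
Qed.

Definition rank1 x : 'L(H) := AdjOp (rank1_subproof x).

Lemma rank1_dag x : (rank1 x)^† = rank1 x.
Proof.
apply: adjOp_adj_unique => u v /=.
by rewrite inner_ractl inner_ract star_inner.
Qed.

(** On the vectors $xa$, iterating [rank1 x] multiplies $a$ by $\langle x, x\rangle$, of norm at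
    most 1. Only the first application costs the constant 4, so all powers share one bound. *)
Lemma rank1_contraction x : rnorm x <= 1 -> bounded_by (rank1 x) 1.
Proof.
move=> x1; apply: (@power_bounded_contraction _ 4) => //.
  exact: rank1_dag.
have ract_le j : forall a : A, rnorm ((rank1 x ^+ j) (ract x a)) <= rnorm a.
  elim: j => [|j IHj] a.
    by rewrite (le_trans (rnorm_ract _ _))// ler_piMl ?rnorm_ge0.
  rewrite exprSr adjOpE /= inner_ract (le_trans (IHj _))//.
  rewrite (le_trans (rnorm_smul _ _))// -rnorm_inner ler_piMl ?rnorm_ge0//.
  by rewrite exprn_ile1 ?rnorm_ge0.
move=> [|j] v; first by rewrite adjOpE; have := rnorm_ge0 v; lra.
rewrite exprSr adjOpE (le_trans (ract_le _ _))//.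
rewrite (le_trans (ler_rnorm_inner4 _ _))// ler_wpM2l//.
by rewrite ler_piMl ?rnorm_ge0.
Qed.

(* The constant 4 of [ler_rnorm_inner4] is improved to its square root by
   [|<x, v>|^2 = |<v, rank1 x v>|], and hence to 1 by iteration. *)
Lemma cauchy_schwarz x y : rnorm ⟨x, y⟩ <= rnorm x * rnorm y.
Proof.
have [/rnorm0_eq0 ->|x0] := eqVneq (rnorm x) 0.
  by rewrite inner0l !rnorm0 mul0r.
have [/rnorm0_eq0 ->|y0] := eqVneq (rnorm y) 0.
  by rewrite inner0r !rnorm0 !mulr0.
have le4 k : forall u v, rnorm u <= 1 -> rnorm v <= 1 ->
    rnorm ⟨u, v⟩ ^+ (2 ^ k) <= 4.
  elim: k => [|k IHk] u v u1 v1.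
    rewrite expr1 (le_trans (ler_rnorm_inner4 _ _))// ler_piMr//.
    by rewrite mulr_ile1// rnorm_ge0.
  rewrite expnS exprM -rnorm_cstar star_inner -inner_ract.
  apply: (IHk _ (rank1 u v)) => //.
  by rewrite (le_trans (rank1_contraction u1 v))// mul1r.
have le1 u v : rnorm u <= 1 -> rnorm v <= 1 -> rnorm ⟨u, v⟩ <= 1.
  move=> u1 v1; apply: (@le_power2_growth _ _ _ 4); rewrite ?rnorm_ge0// => k.
  rewrite expr1n mulr1 (le_trans (le4 k _ _ u1 v1))// ler_peMr//.
  by rewrite ler1n.
have p0 : 0 < rnorm x by rewrite lt_def x0 rnorm_ge0.
have q0 : 0 < rnorm y by rewrite lt_def y0 rnorm_ge0.
have := le1 ((rnorm x)^-1%:C *: x) ((rnorm y)^-1%:C *: y).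
rewrite !rnormZr innerZr rnormZr innerZl.
rewrite conj_Creal; last by apply/complex_realP; exists (rnorm x)^-1.
rewrite rnormZr !ger0_norm ?invr_ge0 ?rnorm_ge0// !mulVf//.
move=> /(_ (lexx _) (lexx _)); rewrite ler_pdivrMl// mulr1 ler_pdivrMl// mulrC.
Qed.

End CauchySchwarz.

(** * Positive operators *)

Section OperatorOrder.
Context {R : realType} {A : cstarAlgType R} {H : hilbertModType A}.
Implicit Types (v : H) (X Y Z : 'L(H)).

Local Notation "⟨ x , y ⟩" := (inner x y : A) (format "⟨ x ,  y ⟩").
Local Notation "r %:I" := (r%:C *: (1 : 'L(H))) (at level 2, format "r %:I").

(** Cancel $|X^† v|$ in $|X^† v|^2 = |\langle X X^† v, v\rangle| \le t |X^† v| |v|$. *)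
Lemma bounded_by_dag X t : bounded_by X t -> bounded_by X^† t.
Proof.
move=> Xt v; have [->|p0] := eqVneq (rnorm (X^† v)) 0.
  exact: bounded_by_ge0 Xt.
have p_gt0 : 0 < rnorm (X^† v) by rewrite lt_def p0 rnorm_ge0.
rewrite -(ler_pM2r p_gt0) -expr2 rnorm_inner -adjOp_adjE.
rewrite (le_trans (cauchy_schwarz _ _))// mulrAC ler_wpM2r ?rnorm_ge0//.
Qed.

Lemma rnorm_sqr_dagM X v : rnorm (X v) ^+ 2 = rnorm ⟨v, (X^† * X) v⟩.
Proof. by rewrite rnorm_inner adjOp_adjE. Qed.

Lemma bounded_by_dagM X t : 0 <= t ->
  bounded_by (X^† * X) (t ^+ 2) -> bounded_by X t.
Proof.
move=> t0 Xt v; have v0 := rnorm_ge0 v.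
rewrite -(@ler_pXn2r _ 2)// ?nnegrE ?mulr_ge0 ?rnorm_ge0//.
rewrite rnorm_sqr_dagM (le_trans (cauchy_schwarz _ _))//.
by rewrite exprMn mulrC [rnorm v ^+ 2]expr2 mulrA ler_wpM2r.
Qed.

Lemma dagM_eq0 X : X^† * X = 0 -> X = 0.
Proof.
move=> XX; apply: adjOp_ext => v; apply: rnorm0_eq0; apply/eqP.
by rewrite -sqrf_eq0 rnorm_sqr_dagM XX inner0r rnorm0.
Qed.

(** A spectral radius argument: self-adjointness and Cauchy-Schwarz give $|Xv|^{2^k} \le |X^{2^k}
    v|$ for $|v| \le 1$, and the linear factor is lost as $k$ grows. *)
Lemma bounded_by_growth X (t K : R) : 0 <= K -> 0 <= t -> X^† = X ->
  (forall n, bounded_by (X ^+ n) (K * n.+1%:R * t ^+ n)) -> bounded_by X t.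
Proof.
move=> K0 t0 Xs XK.
have pow k v : rnorm v <= 1 ->
    rnorm (X v) ^+ (2 ^ k) <= rnorm ((X ^+ (2 ^ k)) v).
  move=> v1; elim: k => [|k IHk]; first by rewrite !expr1.
  rewrite expnS mulnC !exprM.
  have : (rnorm (X v) ^+ (2 ^ k)) ^+ 2 <= rnorm ((X ^+ (2 ^ k)) v) ^+ 2.
    by rewrite lerXn2r// nnegrE ?exprn_ge0 ?rnorm_ge0.
  move/le_trans; apply; rewrite rnorm_sqr_dagM dagX Xs -expr2.
  rewrite (le_trans (cauchy_schwarz _ _))// ler_piMl ?rnorm_ge0//.
have unit v : rnorm v <= 1 -> rnorm (X v) <= t.
  move=> v1; apply: (@le_power2_growth _ _ _ K) => //; first exact: rnorm_ge0.
  move=> k; rewrite (le_trans (pow k v v1))// (le_trans (XK _ _))// ler_piMr//.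
  by rewrite !mulr_ge0// exprn_ge0.
move=> v; have [/rnorm0_eq0 ->|v0] := eqVneq (rnorm v) 0.
  by rewrite raddf0 !rnorm0 mulr0.
have p0 : 0 < rnorm v by rewrite lt_def v0 rnorm_ge0.
have := unit ((rnorm v)^-1%:C *: v).
rewrite linearZ /= !rnormZr !ger0_norm ?invr_ge0 ?rnorm_ge0// mulVf//.
by move=> /(_ (lexx _)); rewrite ler_pdivrMl// mulrC.
Qed.

Definition bounded X := exists2 t, 0 <= t & bounded_by X t.

Lemma bounded1 : bounded 1. Proof. by exists 1 => //; exact: bounded_by1. Qed.

Lemma boundedN X : bounded X -> bounded (- X).
Proof. by case=> t t0 Xt; exists t => //; exact: bounded_byN. Qed.

Lemma boundedD X Y : bounded X -> bounded Y -> bounded (X + Y).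
Proof.
case=> s s0 Xs [t t0 Yt]; exists (s + t); first exact: addr_ge0.
exact: bounded_byD.
Qed.

Lemma boundedB X Y : bounded X -> bounded Y -> bounded (X - Y).
Proof. by move=> bX bY; apply/boundedD/boundedN. Qed.

Lemma boundedM X Y : bounded X -> bounded Y -> bounded (X * Y).
Proof.
case=> s s0 Xs [t t0 Yt]; exists (s * t); first exact: mulr_ge0.
exact: bounded_byM.
Qed.

Lemma boundedZr (r : R) X : 0 <= r -> bounded X -> bounded (r%:C *: X).
Proof.
by move=> r0 [t t0 Xt]; exists (r * t); [exact: mulr_ge0|exact: bounded_byZr].
Qed.

Lemma boundedZi X : bounded X -> bounded ('i *: X).
Proof. by case=> t t0 Xt; exists t => //; exact: bounded_byZi. Qed.

Lemma bounded_dag X : bounded X -> bounded X^†.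
Proof. by case=> t t0 Xt; exists t => //; exact: bounded_by_dag. Qed.

(* Since square roots are available, [|r - X| <= r] characterizes positivity
   of self-adjoint [X], and this form of it is obviously stable under sums. *)
Definition nonneg X := X^† = X /\
  exists2 r : R, 0 <= r & bounded_by (r%:I - X) r.

Lemma scalar_dag (r : R) : r%:I^† = r%:I.
Proof. by rewrite dagZr dag1. Qed.

Lemma bounded_by_scalar (r : R) : 0 <= r -> bounded_by r%:I r.
Proof.
move=> r0; rewrite -[w in bounded_by _ w]mulr1.
exact/bounded_byZr/bounded_by1.
Qed.

Lemma realCD (r s : R) X : (r + s)%:C *: X = r%:C *: X + s%:C *: X.
Proof. by rewrite rmorphD scalerDl. Qed.

Lemma realCM (r s : R) X : (r * s)%:C *: X = r%:C *: (s%:C *: X).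
Proof. by rewrite rmorphM scalerA. Qed.

Lemma realC_VK (r : R) X : r != 0 -> r%:C *: (r^-1%:C *: X) = X.
Proof. by move=> r0; rewrite -realCM divff// scale1r. Qed.

Lemma realC_KV (r : R) X : r != 0 -> r^-1%:C *: (r%:C *: X) = X.
Proof. by move=> r0; rewrite -realCM mulVf// scale1r. Qed.

(** The radius in [nonneg] may be enlarged at will, in particular made positive in order to divide
    by it. *)
Lemma nonneg_gt (s : R) X : nonneg X ->
  exists r, [/\ s <= r, 0 < r & bounded_by (r%:I - X) r].
Proof.
case=> _ [r r0 Xr]; exists (r + (`|s| + 1)); split.
- by have := ler_norm s; lra.
- by rewrite ltr_wpDl// ltr_wpDl.
- rewrite realCD addrAC; apply: bounded_byD => //.
  by apply: bounded_by_scalar; rewrite addr_ge0.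
Qed.

Lemma nonneg_bounded X : nonneg X -> bounded X.
Proof.
case=> _ [r r0 Xr]; exists (r + r); first exact: addr_ge0.
rewrite -[X](@subKr _ r%:I); apply: bounded_byB => //.
exact: bounded_by_scalar.
Qed.

Lemma nonnegD X Y : nonneg X -> nonneg Y -> nonneg (X + Y).
Proof.
case=> Xs [r r0 Xr] [Ys [s s0 Ys']]; split; first by rewrite dagD Xs Ys.
exists (r + s); first exact: addr_ge0.
by rewrite realCD opprD addrACA; exact: bounded_byD.
Qed.

Lemma nonnegZr (k : R) X : 0 <= k -> nonneg X -> nonneg (k%:C *: X).
Proof.
move=> k0 [Xs [r r0 Xr]]; split; first by rewrite dagZr Xs.
exists (k * r); first exact: mulr_ge0.
by rewrite realCM -scalerBr; exact: bounded_byZr.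
Qed.

(** Here $1 - X/r$ is a contraction, so $X/r$ has a root $S$ with $|1 - S| \le 1$; rescaling by
    $\sqrt r$ turns this bound into nonnegativity of the root. *)
Lemma nonneg_sqrt X : nonneg X -> exists S,
  [/\ nonneg S, S ^+ 2 = X &
    forall Y, bounded Y -> X * Y = Y * X -> S * Y = Y * S].
Proof.
move=> nX; have [r [_ r_gt0 Xr]] := nonneg_gt 0 nX.
have r0 := ltW r_gt0; have rN0 := lt0r_neq0 r_gt0.
have xE : r^-1%:C *: (r%:I - X) = 1 - r^-1%:C *: X.
  by rewrite scalerBr realC_KV.
have [|||S [Ss S2 S1 SX]] := @adjOp_sqrt_1B _ _ _ (1 - r^-1%:C *: X) 1.
- by [].
- by rewrite dagB dag1 dagZr (proj1 nX).
- move=> j; rewrite -[w in bounded_by _ w](expr1n _ j).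
  apply: bounded_byX => //.
  rewrite -xE -[w in bounded_by _ w](mulVf rN0).
  by apply: bounded_byZr; rewrite ?invr_ge0.
exists ((Num.sqrt r)%:C *: S); split.
- split; first by rewrite dagZr Ss.
  exists (Num.sqrt r); first exact: sqrtr_ge0.
  rewrite -scalerBr -[w in bounded_by _ w]mulr1.
  by apply: bounded_byZr => //; exact: sqrtr_ge0.
- rewrite expr2 -adjOp_scaleAl -adjOp_scaleAr -realCM -!expr2 sqr_sqrtr// S2.
  by rewrite subKr realC_VK.
- move=> Y [t t0 Yt] XY; rewrite -adjOp_scaleAl -adjOp_scaleAr.
  congr (_ *: _); apply: (SX _ t) => //.
  by rewrite mulrBl mulrBr mul1r mulr1 -adjOp_scaleAl -adjOp_scaleAr XY.
Qed.

(** Scaled by $\sqrt r$, this says $|1 - Y^2| \le 1$ for $|Y| \le 1$. A root $S$ of $1 - Y^2$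
    commutes with $Y$, and $|Sv|^2 \le |\langle v, (S^2 + Y^2) v\rangle| = |v|^2$. *)
Lemma bounded_by_sqrB X s r : X^† = X -> 0 <= s -> bounded_by X s ->
  s ^+ 2 <= r -> bounded_by (r%:I - X ^+ 2) r.
Proof.
move=> Xs s0 Xb sr.
have r0 : 0 <= r by apply: le_trans sr; exact: sqr_ge0.
have [r_eq0|rN0] := eqVneq r 0.
  have s_eq0 : s = 0.
    by apply/eqP; rewrite -sqrf_eq0 eq_le sqr_ge0 andbT -r_eq0.
  have -> : X = 0.
    apply: adjOp_ext => v; apply: rnorm0_eq0; apply/eqP.
    by rewrite eq_le rnorm_ge0 andbT; have := Xb v; rewrite s_eq0 mul0r.
  by rewrite r_eq0 scale0r expr0n /= subr0; exact: bounded_by0.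
pose q := Num.sqrt r; have q2 : q ^+ 2 = r by rewrite sqr_sqrtr.
have q0 : 0 <= q by exact: sqrtr_ge0.
have qN0 : q != 0 by rewrite -sqrf_eq0 q2.
pose Y := q^-1%:C *: X.
have Ys : Y^† = Y by rewrite dagZr Xs.
have Y1 : bounded_by Y 1.
  apply: (@bounded_byW _ _ _ _ (q^-1 * s)); last first.
    by apply: bounded_byZr; rewrite ?invr_ge0.
  rewrite ler_pdivrMl ?lt_def ?qN0// mulr1.
  by rewrite -(@ler_pXn2r _ 2)// ?nnegrE// q2.
have XE : r%:I - X ^+ 2 = r%:C *: (1 - Y ^+ 2).
  rewrite scalerBr; congr (_ - _).
  rewrite -q2 expr2 realCM /Y expr2 -adjOp_scaleAl -adjOp_scaleAr.
  by rewrite ![q%:C *: (q^-1%:C *: _)]realC_VK.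
rewrite XE -[w in bounded_by _ w]mulr1; apply: bounded_byZr => //.
have [||j|S [Ss S2 _ SY]] := @adjOp_sqrt_1B _ _ _ (Y ^+ 2) 1 => //.
- by rewrite dagX Ys.
- rewrite -exprM -[w in bounded_by _ w](expr1n _ (2 * j)).
  exact: bounded_byX.
have YS : Y * S = S * Y.
  by apply/esym/(SY _ 1) => //; rewrite -exprS -exprSr.
have S1 : bounded_by S 1.
  move=> v; rewrite mul1r -(@ler_pXn2r _ 2)// ?nnegrE ?rnorm_ge0//.
  apply: le_trans (rnorm_le_sum_squares v Ss Ys (esym YS)) _.
  by rewrite S2 subrK rnorm_inner.
by rewrite -S2 -[w in bounded_by _ w](expr1n _ 2); exact: bounded_byX.
Qed.

Lemma nonneg_sqr X : X^† = X -> bounded X -> nonneg (X ^+ 2).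
Proof.
move=> Xs [t t0 Xt]; split; first by rewrite dagX Xs.
exists (t ^+ 2); first exact: sqr_ge0.
exact: bounded_by_sqrB Xt _.
Qed.

(** The radius witnessing [nonneg] can thus be any nonnegative bound of [X]: apply [bounded_by_sqrB]
    to a square root. *)
Lemma bounded_by_nonnegB X t :
  nonneg X -> 0 <= t -> bounded_by X t -> bounded_by (t%:I - X) t.
Proof.
move=> nX t0 Xt; have [S [[Ss _] S2 _]] := nonneg_sqrt nX.
rewrite -S2; apply: (@bounded_by_sqrB _ (Num.sqrt t)) => //.
- apply: bounded_by_dagM; first exact: sqrtr_ge0.
  by rewrite Ss -expr2 S2 sqr_sqrtr.
- by rewrite sqr_sqrtr.
Qed.

End OperatorOrder.

Section Positivity.
Context {R : realType} {A : cstarAlgType R} {H : hilbertModType A}.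
Implicit Types (v : H) (X Y Z : 'L(H)).

Local Notation "⟨ x , y ⟩" := (inner x y : A) (format "⟨ x ,  y ⟩").
Local Notation "r %:I" := (r%:C *: (1 : 'L(H))) (at level 2, format "r %:I").

(** A root $S$ of $-X^2$ commutes with $X$, so $|Xv|^2 \le |\langle v, (X^2 + S^2) v\rangle| =
    0$. *)
Lemma nonneg_sqrN_eq0 X : X^† = X -> bounded X -> nonneg (- X ^+ 2) -> X = 0.
Proof.
move=> Xs bX nX; have [S [[Ss _] S2 SX]] := nonneg_sqrt nX.
have XS : X * S = S * X.
  by apply/esym/SX => //; rewrite mulNr mulrN -exprS -exprSr.
apply: adjOp_ext => v; apply: rnorm0_eq0; apply/eqP.
rewrite -sqrf_eq0 eq_le sqr_ge0 andbT.
rewrite (le_trans (rnorm_le_sum_squares v Xs Ss XS))//.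
by rewrite S2 subrr inner0r rnorm0.
Qed.

(* Kaplansky's argument: here [X X^†] is positive, being the difference of
   twice the sum of the squares of the real and imaginary parts of [X] and of
   [X^† X = - Y^2].  The powers of [t - X^† X] are expressed through those of
   [t - X X^†], so [|t + Y^2| <= t] and [- Y^2] is positive as well. *)
Lemma dagM_nonpos_eq0 X Y : bounded X -> Y^† = Y -> bounded Y ->
  X^† * X = - Y ^+ 2 -> X = 0.
Proof.
move=> bX Ys bY XY.
have nXX : nonneg (X * X^†).
  pose re := X + X^†; pose im := 'i *: (X - X^†).
  have res : re^† = re by rewrite dagD dagK addrC.
  have ims : im^† = im by rewrite dagZi dagB dagK -scalerN opprB.
  have bre : bounded re by apply: boundedD => //; exact: bounded_dag.
  have bim : bounded im.
    by apply: boundedZi; apply: boundedB => //; exact: bounded_dag.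
  have -> : X * X^† = (2^-1)%:C *: (re ^+ 2 + im ^+ 2) + Y ^+ 2.
    have -> : re ^+ 2 + im ^+ 2 = (X * X^† + X^† * X) *+ 2.
      rewrite !expr2 /im -adjOp_scaleAl -adjOp_scaleAr scaleii /re.
      by rewrite !(mulrDl, mulrDr, mulNr, mulrN) opprK sum4_sub.
    rewrite -[(_ + _) *+ 2]scaler_nat scalerA mulrC realC_half_mul2 scale1r XY.
    by rewrite -addrA addNr addr0.
  apply: nonnegD; last exact: nonneg_sqr.
  apply: nonnegZr; first by rewrite invr_ge0.
  by apply: nonnegD; exact: nonneg_sqr.
(* Taking $t \ge 1$ lets $t^n$ be absorbed in $t^{n+1}$ in the induction below. *)
have [t [t1 t_gt0 Xt]] := nonneg_gt 1 nXX; have t0 := ltW t_gt0.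
have [s s0 Xs] := bX.
pose a := t%:I - X^† * X; pose b := t%:I - X * X^†.
have ab n : a ^+ n * X^† = X^† * b ^+ n.
  elim: n => [|n IHn]; first by rewrite mul1r mulr1.
  rewrite exprS -mulrA IHn !mulrA exprS mulrA; congr (_ * _).
  by rewrite mulrBl mulrBr -adjOp_scaleAl -adjOp_scaleAr mul1r mulr1 mulrA.
have as_ : a^† = a by rewrite dagB scalar_dag dagM dagK.
have at_ : bounded_by a t.
  pose K := 1 + s ^+ 2; have K0 : 0 <= K by rewrite addr_ge0 ?sqr_ge0.
  apply: (@bounded_by_growth _ _ _ _ _ K) => // n.
  elim: n => [|n IHn].
    rewrite !expr0 !mulr1; apply: bounded_byW (@bounded_by1 _ _ _).
    by rewrite lerDl sqr_ge0.
  rewrite exprSr {2}/a mulrBr mulrA ab -adjOp_scaleAr mulr1.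
  (* Since $a^{n+1} = t a^n - X^† b^n X$ and $|b| \le t$, each step adds at most $s^2 t^n$: the
     growth is linear up to the factor $t^n$. *)
  apply: (@bounded_byW _ _ _ _ (t * (K * n.+1%:R * t ^+ n) + s * t ^+ n * s)).
    have -> : K * n.+2%:R * t ^+ n.+1 =
        t * (K * n.+1%:R * t ^+ n) + K * (t * t ^+ n).
      by rewrite exprS -[n.+2%:R]natr1; ring.
    rewrite lerD2l (_ : s * t ^+ n * s = s ^+ 2 * t ^+ n); last by ring.
    rewrite ler_pM ?sqr_ge0 ?exprn_ge0//.
      by rewrite lerDr.
    by rewrite ler_peMl// exprn_ge0.
  apply: bounded_byB; first exact: bounded_byZr.
  apply: bounded_byM => //; first by rewrite mulr_ge0// exprn_ge0.
  by apply: bounded_byM => //; [exact: bounded_by_dag | exact: bounded_byX].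
apply: dagM_eq0; rewrite XY.
suff -> : Y = 0 by rewrite expr0n oppr0.
apply: nonneg_sqrN_eq0 => //; split; first by rewrite dagN dagX Ys.
by exists t => //; rewrite -XY.
Qed.

(** With $h = X^† X$ and $w$ the root of $h^2$, the operator $d = w - h$ is twice the negative part
    of $h$. From $wd = -hd$ one gets $(Xd)^† (Xd) = -(vd)^2$ for $v$ a root of $w$, so $Xd = 0$,
    then $hd = wd = 0$ and $d^2 = 0$. *)
Lemma dagM_nonneg X : bounded X -> nonneg (X^† * X).
Proof.
move=> bX; set h := X^† * X.
have hs : h^† = h by rewrite dagM dagK.
have bh : bounded h by apply: boundedM => //; exact: bounded_dag.
have [w [nw w2 wY]] := nonneg_sqrt (nonneg_sqr hs bh).
have bw := nonneg_bounded nw.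
have wh : w * h = h * w by apply: wY => //; rewrite -exprS -exprSr.
have [v [nv v2 vY]] := nonneg_sqrt nw.
have bv := nonneg_bounded nv.
have vh : v * h = h * v by exact: vY.
have vw : v * w = w * v by exact: vY.
suff -> : h = w by [].
pose d := w - h.
have ds : d^† = d by rewrite dagB hs (proj1 nw).
have bd : bounded d by exact: boundedB.
have wd : w * d = - (h * d).
  by rewrite /d !mulrBr -!expr2 w2 opprB wh.
have vd : v * d = d * v by rewrite /d mulrBl mulrBr vh vw.
have Xd : X * d = 0.
  apply: (@dagM_nonpos_eq0 _ (v * d)).
  - exact: boundedM.
  - by rewrite dagM ds (proj1 nv).
  - exact: boundedM.
  - rewrite dagM ds mulrA -[d * _ * X]mulrA -/h -mulrA.
    have -> : h * d = - (w * d) by rewrite wd opprK.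
    rewrite mulrN; congr (- _).
    by rewrite expr2 {1}vd -mulrA [v * (v * d)]mulrA -expr2 v2.
have hd : h * d = 0 by rewrite /h -mulrA Xd mulr0.
apply/esym/subr0_eq; rewrite -/d; apply: dagM_eq0; rewrite ds.
by rewrite {1}/d mulrBl wd hd oppr0 addr0.
Qed.

(** Converts geometric decay into the rate expected by [adjOp_lim]. The induction needs the sharper
    bound $(1 + r)/(n + 1 + r)$. *)
Lemma geometric_le_inv (r : R) n : 0 <= r ->
  (r / (1 + r)) ^+ n <= (1 + r) / n.+1%:R.
Proof.
move=> r0; have r1 : 0 < 1 + r by rewrite ltr_wpDr.
have q0 : 0 <= r / (1 + r) by rewrite divr_ge0// ltW.
apply: (@le_trans _ _ ((1 + r) / (n.+1%:R + r))); last first.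
  by rewrite ler_wpM2l ?(ltW r1)// lef_pV2 ?posrE ?ltr_wpDr// lerDl.
elim: n => [|n IHn]; first by rewrite expr0 divff// lt0r_neq0.
rewrite exprS (le_trans (ler_wpM2l q0 IHn))//.
have n0 : 0 < n.+1%:R + r by rewrite ltr_wpDr.
rewrite mulrA divfK ?lt0r_neq0// ler_pdivrMr// mulrAC ler_pdivlMr; last first.
  by rewrite ltr_wpDr.
rewrite -[n.+2%:R]natr1; have := ler0n R n.+1; move: (n.+1%:R) => m m0; nra.
Qed.

(** A Neumann series: $1 + X = (1 + r)(1 - x)$ with $x = (r - X)/(1 + r)$ of norm at most $r/(1 + r)
    < 1$. One one-sided inverse is computed, and taking adjoints gives the other. *)
Lemma nonneg_inv1D X : nonneg X -> exists Y,
  [/\ Y^† = Y, bounded Y, Y * (1 + X) = 1 & (1 + X) * Y = 1].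
Proof.
move=> nX; have [r [_ r_gt0 Xr]] := nonneg_gt 0 nX; have r0 := ltW r_gt0.
have r1 : 0 < 1 + r by rewrite ltr_wpDr.
have r1N0 := lt0r_neq0 r1.
pose q := r / (1 + r); have q0 : 0 <= q by rewrite divr_ge0// ltW.
have qE : (1 + r) * q = r by rewrite mulrC divfK.
pose x := (1 + r)^-1%:C *: (r%:I - X).
have xs : x^† = x by rewrite dagZr dagB scalar_dag (proj1 nX).
have xq : bounded_by x q.
  by rewrite /q mulrC; apply: bounded_byZr => //; rewrite invr_ge0 ltW.
have XE : 1 + X = (1 + r)%:C *: (1 - x).
  rewrite scalerBr realC_VK// realCD scale1r opprB.
  by rewrite addrACA subrr addr0.
pose y n := \sum_(i < n) x ^+ i.
have ys n : (y n)^† = y n.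
  elim: n => [|n IHn]; rewrite /y ?big_ord0 ?dag0// big_ord_recr /= dagD.
  by rewrite -/(y n) IHn dagX xs.
have ymul n : y n * (1 - x) = 1 - x ^+ n.
  elim: n => [|n IHn]; first by rewrite /y big_ord0 mul0r subrr.
  rewrite /y big_ord_recr /= -/(y n) mulrDl IHn mulrBr mulr1 -exprSr.
  by rewrite addrA subrK.
have yd n m : (n <= m)%N ->
    bounded_by (y m - y n) ((1 + r) * (q ^+ n - q ^+ m)).
  elim: m => [|m IHm].
    by rewrite leqn0 => /eqP ->; rewrite !subrr mulr0; exact: bounded_by0.
  rewrite leq_eqVlt => /predU1P[->|nm].
    by rewrite !subrr mulr0; exact: bounded_by0.
  have -> : y m.+1 - y n = (y m - y n) + x ^+ m.
    by rewrite /y big_ord_recr /= addrAC.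
  have -> : (1 + r) * (q ^+ n - q ^+ m.+1) =
      (1 + r) * (q ^+ n - q ^+ m) + q ^+ m.
    by rewrite exprS [LHS]mulrBr mulrA qE; ring.
  by apply: bounded_byD; [exact: IHm | exact: bounded_byX].
(* One factor is $1/(1 - q)$, from summing the series; the other comes from [geometric_le_inv]. *)
pose K := (1 + r) * (1 + r).
have yK n m : (n <= m)%N -> bounded_by (y m - y n) (K / n.+1%:R).
  move=> nm; apply: bounded_byW (yd n m nm).
  rewrite -mulrA ler_wpM2l ?(ltW r1)//.
  apply: le_trans (geometric_le_inv n r0).
  by rewrite lerBlDr lerDl exprn_ge0.
have K0 : 0 <= K by rewrite mulr_ge0// ltW.
have [Y Ys YK] := adjOp_lim K0 ys yK.
have bY : bounded Y.
  exists (K / 1%:R); first by rewrite divr1.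
  by rewrite -[Y]subr0; have := YK 0; rewrite {1}/y big_ord0.
have Yx : Y * (1 - x) = 1.
  apply: (@adjOp_eq_lim _ _ _ _ _ (K * (1 + q) + (1 + r))) => n.
  have -> : Y * (1 - x) - 1 = (Y - y n) * (1 - x) - x ^+ n.
    by rewrite mulrBl ymul opprB [x ^+ n - 1]addrC addrA addrK.
  rewrite [w in bounded_by _ w]mulrDl; apply: bounded_byB; last first.
    by apply: bounded_byW (geometric_le_inv n r0) _; exact: bounded_byX.
  rewrite mulrAC; apply: bounded_byM => //; first by rewrite divr_ge0.
  by apply: bounded_byB => //; exact: bounded_by1.
have YX : ((1 + r)^-1%:C *: Y) * (1 + X) = 1.
  by rewrite XE -adjOp_scaleAl -adjOp_scaleAr Yx realC_KV.
exists ((1 + r)^-1%:C *: Y); split => //.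
- by rewrite dagZr Ys.
- by apply: boundedZr => //; rewrite invr_ge0 ltW.
- have := congr1 (@adjOp_adj _ _ H) YX.
  by rewrite dagM dagZr Ys dagD dag1 (proj1 nX).
Qed.

End Positivity.

(** * Complements of idempotents *)

Section OperatorNorm.
Context {R : realType} {A : cstarAlgType R} {H : hilbertModType A}.
Implicit Types (v : H) (S T : 'L(H)).

Lemma opnorm_le T r : 0 <= r -> bounded_by T r -> (opnorm T <= r%:E)%E.
Proof.
move=> r0 Tr; apply: ge_ereal_sup => _ [v /= v1 <-]; rewrite lee_fin.
rewrite (le_trans (Tr v))// ler_piMr//.
by move: v1; rewrite normE lecR.
Qed.

Lemma bounded_by_opnorm T r : (opnorm T <= r%:E)%E -> bounded_by T r.
Proof.
move=> Tr v; have unit u : rnorm u <= 1 -> rnorm (T u) <= r.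
  move=> u1; rewrite -lee_fin; apply: le_trans Tr.
  by apply: ereal_sup_ubound; exists u => //=; rewrite normE lecR.
have [/rnorm0_eq0 ->|v0] := eqVneq (rnorm v) 0.
  by rewrite raddf0 !rnorm0 mulr0.
have p0 : 0 < rnorm v by rewrite lt_def v0 rnorm_ge0.
have := unit ((rnorm v)^-1%:C *: v).
rewrite linearZ /= !rnormZr !ger0_norm ?invr_ge0 ?rnorm_ge0// mulVf//.
by move=> /(_ (lexx _)); rewrite ler_pdivrMl// mulrC.
Qed.

Lemma opnorm_ge0 T : (0 <= opnorm T)%E.
Proof.
apply: ereal_sup_ubound; exists 0; last by rewrite raddf0 normr0.
by rewrite /= normr0 ler01.
Qed.

(** Reduces comparisons of extended norms to finite bounds; an infinite right side leaves nothing to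
    prove. *)
Lemma opnorm_mono S T :
  (forall r, 0 <= r -> bounded_by T r -> bounded_by S r) ->
  (opnorm S <= opnorm T)%E.
Proof.
move=> ST; have := @bounded_by_opnorm T.
case: (opnorm T) (opnorm_ge0 T) => [r|_ _|//]; last by rewrite leey.
rewrite lee_fin => r0 Tr; apply: opnorm_le => //.
by apply: ST => //; exact: Tr.
Qed.

End OperatorNorm.

Section Idempotent.
Context {R : realType} {A : cstarAlgType R} {H : hilbertModType A}.
Implicit Types (v : H) (X Y Z : 'L(H)).
Variable Q : 'L(H).
Hypothesis QQ : Q * Q = Q.

Let pp : Q^† * Q^† = Q^†. Proof. by rewrite -dagM QQ. Qed.
Let QcQ : (1 - Q) * Q = 0. Proof. by rewrite mulrBl mul1r QQ subrr. Qed.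
Let pcp : (1 - Q^†) * Q^† = 0. Proof. by rewrite mulrBl mul1r pp subrr. Qed.

Lemma idempotent_bound_ge1 M : Q != 0 -> bounded_by Q M -> 1 <= M.
Proof.
move=> Q0 QM; have [v Qv] : exists v, Q v != 0.
  apply: contrapT => /forallNP Qv; move/eqP: Q0; apply; apply: adjOp_ext => v.
  by apply/eqP/negPn/negP; exact: Qv.
have v0 : 0 < rnorm (Q v).
  rewrite lt_def rnorm_ge0 andbT; apply: contra_neq Qv; exact: rnorm0_eq0.
by rewrite -(ler_pM2r v0) mul1r -{1}QQ; exact: QM.
Qed.

(* The powers of [(1 - Q)^† (1 - Q)] are expressed through those of [Q^† Q],
   hence grow at most like those of [|Q|^2]. *)
Lemma idempotent_compl_bound M : Q != 0 ->
  bounded_by Q M -> bounded_by (1 - Q) M.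
Proof.
move=> Q0 QM; have M1 := idempotent_bound_ge1 Q0 QM.
have M0 : 0 <= M by apply: le_trans M1.
pose W := (1 - Q^†) * (1 - Q).
pose V n := (1 - Q^†) * Q * (Q^† * Q) ^+ n * Q^† * (1 - Q).
have WLQ : W * ((1 - Q^†) * Q) = (1 - Q^†) * Q * (Q^† * Q).
  rewrite /W -mulrA.
  have -> : (1 - Q) * ((1 - Q^†) * Q) = Q * (Q^† * Q) - Q^† * Q.
    rewrite [(1 - Q^†) * Q]mulrBl mul1r mulrBr QcQ sub0r.
    by rewrite [(1 - Q) * _]mulrBl mul1r opprB.
  by rewrite mulrBr [(1 - Q^†) * (Q^† * Q)]mulrA pcp mul0r subr0 !mulrA.
have QcQc : (1 - Q) * (1 - Q) = 1 - Q by rewrite mulrBr mulr1 QcQ subr0.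
have WW : W * W = W + V 0.
  have -> : W * W = (1 - Q^†) * ((1 - Q) * ((1 - Q^†) * (1 - Q))).
    by rewrite /W !mulrA.
  have -> : (1 - Q) * ((1 - Q^†) * (1 - Q)) =
      (1 - Q) - Q^† * (1 - Q) + Q * (Q^† * (1 - Q)).
    rewrite [(1 - Q^†) * (1 - Q)]mulrBl mul1r mulrBr QcQc.
    by rewrite [(1 - Q) * (_ * _)]mulrBl mul1r opprB addrA addrAC.
  rewrite mulrDr mulrBr [(1 - Q^†) * (Q^† * (1 - Q))]mulrA pcp mul0r subr0.
  by rewrite /V expr0 mulr1 !mulrA.
have WV n : W * V n = V n.+1.
  by rewrite /V !mulrA -[W * _ * Q]mulrA WLQ exprS !mulrA.
(* The powers telescope, and [V n] is of the order of $M^{2(n+1)}$: $W^n$ thus grows at most like $n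
   M^{2n}$, as [bounded_by_growth] requires. *)
have WS n : W ^+ n.+2 = W ^+ n.+1 + V n.
  elim: n => [|n IHn]; first by rewrite expr2 WW.
  by rewrite [LHS]exprS {1}IHn mulrDr WV -exprS.
have Qc : bounded_by (1 - Q) (1 + M).
  by apply: bounded_byB => //; exact: bounded_by1.
have pM : bounded_by Q^† M by exact: bounded_by_dag.
have pc : bounded_by (1 - Q^†) (1 + M).
  by apply: bounded_byB => //; exact: bounded_by1.
have M10 : 0 <= 1 + M by exact: addr_ge0.
have VM n : bounded_by (V n) ((1 + M) * M * (M * M) ^+ n * M * (1 + M)).
  have n0 : 0 <= (M * M) ^+ n by rewrite exprn_ge0 ?mulr_ge0.
  have MM0 : 0 <= M * M by exact: mulr_ge0.
  have pQn : bounded_by ((Q^† * Q) ^+ n) ((M * M) ^+ n).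
    by apply: bounded_byX => //; exact: bounded_byM.
  have b1 := bounded_byM M10 pc QM.
  have b2 := bounded_byM (mulr_ge0 M10 M0) b1 pQn.
  have b3 := bounded_byM (mulr_ge0 (mulr_ge0 M10 M0) n0) b2 pM.
  exact: bounded_byM (mulr_ge0 (mulr_ge0 (mulr_ge0 M10 M0) n0) M0) b3 Qc.
have MM : 1 <= M ^+ 2 by rewrite expr2; nra.
pose K := (1 + M) * (1 + M); have K0 : 0 <= K by exact: mulr_ge0.
have KW n : bounded_by (W ^+ n) (K * n.+1%:R * (M ^+ 2) ^+ n).
  case: n => [|n].
    apply: bounded_byW (@bounded_by1 _ _ _); rewrite expr0 !mulr1 /K.
    by nra.
  elim: n => [|n IHn].
    apply: (@bounded_byW _ _ _ _ K); last exact: bounded_byM.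
    by rewrite expr1 -mulrA ler_peMr//; nra.
  rewrite WS; apply: bounded_byW (bounded_byD IHn (VM n)).
  have -> : (1 + M) * M * (M * M) ^+ n * M * (1 + M) = K * (M ^+ 2) ^+ n.+1.
    by rewrite exprS /K -expr2; ring.
  rewrite -[n.+3%:R]natr1 [(M ^+ 2) ^+ n.+2]exprS.
  have : 0 <= (M ^+ 2) ^+ n.+1 by rewrite exprn_ge0// sqr_ge0.
  have := ler0n R n.+2; move: (n.+2%:R) (M ^+ 2) MM ((M ^+ 2) ^+ n.+1).
  move=> m q q1 w m0 w0.
  have -> : K * m * w + K * w = K * ((m + 1) * w) by ring.
  by rewrite -mulrA ler_wpM2l// ler_wpM2l ?addr_ge0// ler_peMl.
apply: bounded_by_dagM => //; rewrite dagB dag1 -/W.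
apply: (bounded_by_growth K0) => //; first exact: sqr_ge0.
by rewrite dagM !dagB dagK dag1.
Qed.

End Idempotent.

(** * The matched projection *)

Section RingInverses.
Context {T : pzRingType}.
Implicit Types x y z : T.

Lemma commute_inv x y z :
  x * y = 1 -> y * x = 1 -> z * x = x * z -> z * y = y * z.
Proof.
move=> xy yx zx.
rewrite -[z * y]mul1r -yx -!mulrA [x * _]mulrA -zx.
by rewrite -[z * x * y]mulrA xy mulr1.
Qed.

Lemma inv_of_sqr x y : x * x * y = 1 -> y * (x * x) = 1 ->
  x * (x * y) = 1 /\ x * y * x = 1.
Proof.
move=> xy yx; have cxy : x * y = y * x.
  by apply: commute_inv xy yx _; rewrite mulrA.
by rewrite mulrA xy cxy -mulrA yx.
Qed.

End RingInverses.

Section MatchedPair.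
Context {R : realType} {A : cstarAlgType R} {H : hilbertModType A}.
Implicit Types (v : H) (X Y Z : 'L(H)).

Lemma bounded_dagM X : bounded (X^† * X) -> bounded X.
Proof.
case=> t t0 Xt; exists (Num.sqrt t); first exact: sqrtr_ge0.
by apply: bounded_by_dagM; rewrite ?sqr_sqrtr// sqrtr_ge0.
Qed.

Lemma nonneg_conj X Y : nonneg X -> bounded Y -> nonneg (Y^† * X * Y).
Proof.
move=> nX bY; have [S [nS <- _]] := nonneg_sqrt nX.
have -> : Y^† * S ^+ 2 * Y = (S * Y)^† * (S * Y).
  by rewrite dagM (proj1 nS) expr2 !mulrA.
by apply/dagM_nonneg/boundedM => //; exact: nonneg_bounded.
Qed.

Lemma nonneg1 : nonneg (1 : 'L(H)).
Proof.
by rewrite -(expr1n _ 2); apply: nonneg_sqr; [exact: dag1 | exact: bounded1].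
Qed.

Lemma bounded_by_projection (P : 'L(H)) :
  P^† = P -> P * P = P -> bounded_by P 1.
Proof.
move=> Ps PP v; have [->|Pv0] := eqVneq (rnorm (P v)) 0.
  by rewrite mul1r rnorm_ge0.
have Pv_gt0 : 0 < rnorm (P v) by rewrite lt_def Pv0 rnorm_ge0.
rewrite mul1r -(ler_pM2r Pv_gt0) -expr2 rnorm_sqr_dagM Ps PP.
exact: cauchy_schwarz.
Qed.

(* [G = Q + Q^† - 1] is invertible because [G^2 = 1 + (i(Q - Q^†))^2], and
   [Q G^-1] is the projection onto the range of [Q]. *)
Lemma range_projection (Q : 'L(H)) : Q * Q = Q -> bounded Q ->
  exists P : 'L(H), [/\ P^† = P, P * P = P, P * Q = Q & Q * P = P].
Proof.
move=> QQ bQ; pose p := Q^†.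
have pp : p * p = p by rewrite -dagM QQ.
pose G := Q + p - 1; pose K := 'i *: (Q - p).
have Ks : K^† = K by rewrite dagZi dagB dagK -scalerN opprB.
have bK : bounded K by apply/boundedZi/boundedB => //; exact: bounded_dag.
have [Y [Ys _ YG GY]] := nonneg_inv1D (nonneg_sqr Ks bK).
have GG : 1 + K ^+ 2 = G * G.
  rewrite expr2 /K -adjOp_scaleAl -adjOp_scaleAr scaleii /G.
  have sd : (Q + p) * (Q + p) = (Q + p) *+ 2 - (Q - p) * (Q - p).
    apply/esym/eqP; rewrite subr_eq; apply/eqP.
    rewrite !(mulrDl, mulrDr, mulNr, mulrN) QQ pp opprK addrACA.
    rewrite [Q + _ + (Q - _)]addrACA subrr addr0.
    by rewrite [_ + p + (_ + p)]addrACA subrr add0r mulr2n addrACA.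
  have -> : (Q + p - 1) * (Q + p - 1) =
      (Q + p) * (Q + p) - (Q + p) - (Q + p - 1).
    by rewrite mulrBl mul1r mulrBr mulr1.
  rewrite sd mulr2n [Q + p + (Q + p) - _]addrAC addrK.
  by rewrite opprB [Q + p - _]addrC addrACA subrr addr0 addrC.
rewrite GG in YG GY; have [GGi GiG] := inv_of_sqr GY YG.
pose Gi := G * Y; rewrite -/Gi in GGi GiG.
have GQ : G * Q = p * Q by rewrite /G mulrBl mulrDl QQ mul1r addrAC subrr add0r.
have pG : p * G = p * Q by rewrite /G mulrBr mulrDr pp mulr1 addrK.
have Gs : G^† = G by rewrite dagB dagD dag1 -/p (dagK Q) [p + Q]addrC.
have GY' : G * Y = Y * G by apply: commute_inv GY YG _; rewrite mulrA.
have Gis : Gi^† = Gi by rewrite dagM Ys Gs -GY'.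
(* From $GQ = Q^† Q = Q^† G$; it makes $Q G^{-1}$ self-adjoint. *)
have QGi : Gi * p = Q * Gi.
  rewrite -[Q * Gi]mul1r -GiG -!mulrA [G * (Q * _)]mulrA GQ.
  by rewrite -pG -mulrA GGi mulr1.
have PQ : Q * Gi * Q = Q by rewrite -QGi -mulrA -GQ mulrA GiG mul1r.
exists (Q * Gi); split => //.
- by rewrite dagM Gis.
- by rewrite mulrA PQ.
- by rewrite mulrA QQ.
Qed.

(** * The block matrix as an operator on [H] *)

Section MatchedBound.
(** [C] plays the role of $B$ extended to [H], with inverses [a] of [C] and [e] of [1 + C]. *)
Variables Q P C a e : 'L(H).
Hypotheses (QQ : Q * Q = Q) (Ps : P^† = P) (PP : P * P = P).
Hypotheses (PQ : P * Q = Q) (QP : Q * P = P).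
Let T : 'L(H) := Q - P.
Hypotheses (nC : nonneg C) (CP : P * C = C * P) (CC : C * C = 1 + T * T^†).
Hypotheses (bQ : bounded Q) (ba : bounded a) (be : bounded e).
Hypotheses (as_ : a^† = a) (es : e^† = e).
Hypotheses (aC : a * C = 1) (Ca : C * a = 1).
Hypotheses (eC : e * (1 + C) = 1) (Ce : (1 + C) * e = 1).

Let PT : P * T = T. Proof. by rewrite mulrBr PQ PP. Qed.
Let TP : T * P = 0. Proof. by rewrite mulrBl QP PP subrr. Qed.
Let TdP : T^† * P = T^†. Proof. by rewrite -{1}Ps -dagM PT. Qed.
Let PTd : P * T^† = 0. Proof. by rewrite -{1}Ps -dagM TP dag0. Qed.
Let QE : Q = P + T. Proof. by rewrite addrC subrK. Qed.
Let aP : P * a = a * P. Proof. exact: commute_inv Ca aC CP. Qed.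
Let eP : P * e = e * P.
Proof. by apply: commute_inv Ce eC _; rewrite mulrDr mulrDl mulr1 mul1r CP. Qed.
Let Ce' : C * e = e * C.
Proof. by apply: commute_inv Ce eC _; rewrite mulrDr mulrDl mulr1 mul1r. Qed.
Let ae : a * e = e * a.
Proof. by apply/esym; apply: commute_inv Ca aC _; rewrite Ce'. Qed.

Let CP1 : P * (1 + C) = (1 + C) * P.
Proof. by rewrite mulrDr mulrDl mulr1 mul1r CP. Qed.
Let Ca1 : (1 + C) * a = a * (1 + C).
Proof. by rewrite mulrDr mulrDl mulr1 mul1r aC Ca. Qed.
Let aeE : a * e = a - e.
Proof.
apply/esym/eqP; rewrite subr_eq; apply/eqP.
by rewrite -{1}[a]mulr1 -Ce mulrA mulrDr mulr1 aC mulrDl mul1r.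
Qed.
Let Cae : (1 + C) * (a * e) = a.
Proof. by rewrite mulrA Ca1 -mulrA Ce mulr1. Qed.
Let aeC : (a * e) * (1 + C) = a.
Proof. by rewrite -mulrA eC mulr1. Qed.

(** The block matrix without its factor 1/2 factors as [N] below, which [NE] expands into the four
    entries. With $L L^† = 2 C (1 + C) P$ this yields $N^2 = 2N$. *)
Let L : 'L(H) := (1 + C) * P + T.
Let N : 'L(H) := L^† * (a * e) * L.

Let LdE : L^† = P * (1 + C) + T^†.
Proof. by rewrite dagD dagM Ps dagD dag1 (proj1 nC). Qed.

Let PL : P * L = L.
Proof. by rewrite /L mulrDr PT mulrA CP1 -mulrA PP. Qed.

Let PaeL : P * (a * e * L) = a * e * L.
Proof. by rewrite mulrA mulrA aP -[a * P * e]mulrA eP !mulrA -mulrA PL. Qed.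

Let aeL : a * e * L = a * P + a * e * T.
Proof. by rewrite mulrDr mulrA aeC. Qed.

Let NE :
  N = (1 + C) * a * P + a * T + (T^† * a * P + T^† * (a * e) * T).
Proof.
rewrite /N -mulrA LdE mulrDl CP1 -mulrA PaeL aeL !mulrDr !mulrA.
by rewrite -[(1 + C) * a * e]mulrA Cae.
Qed.

(** Since $T T^† = (C^2 - 1) P$, the sum is $((1 + C)^2 + C^2 - 1) P$. *)
Let LL : L * L^† = (C * (1 + C) * P) *+ 2.
Proof.
rewrite LdE mulrDl [_ * P * (_ + _)]mulrDr [T * (_ + _)]mulrDr.
rewrite -[(1 + C) * P * T^†]mulrA PTd mulr0 addr0.
rewrite [T * (P * _)]mulrA TP mul0r add0r.
have -> : T * T^† = (C * C - 1) * P by rewrite CC addrC addKr -mulrA TdP.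
rewrite -[_ * P * _]mulrA [P * (P * _)]mulrA PP CP1 mulrA -mulrDl -mulrnAl.
congr (_ * _); rewrite [(1 + C) * _]mulrDl mul1r mulrDr mulr1 mulr2n.
by rewrite addrC -[1 + C + _]addrA addrA subrK addrA [_ + C]addrC.
Qed.

Let NN : N * N = N *+ 2.
Proof.
have LLaeL : L * (L^† * (a * e * L)) = L *+ 2.
  rewrite mulrA LL mulrnAl; congr (_ *+ 2).
  by rewrite -mulrA PaeL mulrA -[C * (1 + C) * _]mulrA Cae Ca mul1r.
have LN : L * N = L *+ 2 by rewrite /N -mulrA LLaeL.
by rewrite {1}/N -mulrA LN mulrnAr.
Qed.

Let Ns : N^† = N.
Proof. by rewrite /N !dagM dagK as_ es ae mulrA. Qed.

Let J : 'L(H) := N - 1.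

Let Js : J^† = J. Proof. by rewrite dagB Ns dag1. Qed.

Let JJ : J * J = 1.
Proof.
by rewrite mulrBl mulrBr mulr1 mul1r NN opprB mulr2n addrK addrC subrK.
Qed.

Let J1 : bounded_by J 1.
Proof.
by apply: bounded_by_dagM => //; rewrite Js JJ expr1n; exact: bounded_by1.
Qed.

Let om : 'L(H) := Q^† * a * Q + (1 - P) + T^† * e * T.

(** As [J * J = 1], [J] and [om] are the factors of a polar decomposition of $2Q - 1$. The
    computation rests on $TQ = 0$, hence $LQ = (1 + C) Q$. *)
Let omE : J * (Q *+ 2 - 1) = om.
Proof.
have LQ : L * Q = (1 + C) * Q.
  by rewrite mulrDl -mulrA PQ [T * Q]mulrBl QQ PQ subrr addr0.
have aQE : a * Q = a * P + a * T by rewrite -mulrDr -QE.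
have aeLQ : a * e * L * (Q *+ 2 - 1) = a * Q + e * T.
  rewrite mulrBr mulr1 mulrnAr -[_ * L * Q]mulrA LQ [_ * (_ * Q)]mulrA aeC.
  rewrite aeL aeE mulrBl addrA -aQE opprB mulr2n -addrA.
  by congr (_ + _); rewrite addrCA subrr addr0.
have NQ : N * (Q *+ 2 - 1) = a * Q + Q + T + T^† * (a * Q + e * T).
  rewrite /N -[L^† * _ * L]mulrA -mulrA aeLQ LdE mulrDl; congr (_ + _).
  rewrite mulrDr -!mulrA [(1 + C) * (a * Q)]mulrA [(1 + C) * (e * T)]mulrA.
  rewrite Ce mul1r PT Ca1 mulrDr mulr1 aC mulrDl mul1r mulrDr PQ.
  by rewrite mulrA aP -mulrA PQ.
have QaQ : Q^† * a * Q = a * Q + T^† * (a * Q).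
  by rewrite {1}QE dagD Ps !mulrDl aP -!mulrA PQ.
have QT : Q + T - (Q *+ 2 - 1) = 1 - P.
  by rewrite /T addrA -mulr2n opprB [Q *+ 2 - P]addrC addrACA subrr addr0 addrC.
rewrite mulrBl mul1r NQ /om QaQ mulrDr -[T^† * e * T]mulrA addrAC.
rewrite -[_ + Q + T]addrA -[a * Q + _ - _]addrA QT addrA.
by rewrite [a * Q + _ + _]addrAC.
Qed.

Let nom : nonneg om.
Proof.
(* Write $a = a^† C a$, and likewise $e = e^† (1 + C) e$. *)
have na : nonneg a.
  by rewrite -[a]mulr1 -Ca mulrA -{1}as_; exact: nonneg_conj.
have ne : nonneg e.
  rewrite -[e]mulr1 -Ce mulrA -{1}es; apply: nonneg_conj => //.
  by apply: nonnegD => //; exact: nonneg1.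
have bP : bounded P by exists 1 => //; exact: bounded_by_projection.
have bT : bounded T by exact: boundedB.
apply: nonnegD; last exact: nonneg_conj.
apply: nonnegD; first exact: nonneg_conj.
have -> : 1 - P = (1 - P)^† * (1 - P).
  by rewrite dagB dag1 Ps mulrBr mulr1 mulrBl mul1r PP subrr subr0.
by apply: dagM_nonneg; apply: boundedB => //; exact: bounded1.
Qed.

(* [J (2Q - 1) = om] is positive, hence [2(m - Q) = J - (2Q - 1) = J (1 - om)],
   and [|1 - om| <= t] for [t = 2|Q| >= |Q| + |1 - Q| >= |om|]. *)
Lemma matched_bound M : Q != 0 -> bounded_by Q M ->
  bounded_by (2^-1 *: ((1 + C) * a * P + a * T +
    (T^† * a * P + T^† * (a * e) * T)) - Q) M.
Proof.
rewrite -NE => Q0 QM; have M1 := idempotent_bound_ge1 QQ Q0 QM.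
pose t := M + M; have t0 : 0 <= t by rewrite /t; lra.
have QMt : bounded_by (Q *+ 2 - 1) t.
  rewrite mulr2n -addrA; apply: bounded_byD => //.
  by rewrite -opprB; apply/bounded_byN/idempotent_compl_bound.
have omt : bounded_by om t.
  by rewrite -omE -[t]mul1r; exact: bounded_byM.
have tN0 : t != 0 by rewrite /t; lra.
(* Split $t(1 - om)$ as $(t - om) - (t - 1) om$, with bounds $t$ and $(t - 1) t$ adding up to $t^2$;
   here $t \ge 2$. *)
have om1 : bounded_by (1 - om) t.
  have -> : 1 - om = t^-1%:C *: ((t%:C *: (1 : 'L(H)) - om) - (t - 1)%:C *: om).
    rewrite rmorphB rmorph1 scalerBl scale1r opprB addrA subrK.
    by rewrite -scalerBr realC_KV.
  have tE : t^-1 * (t + (t - 1) * t) = t by field.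
  rewrite -[w in bounded_by _ w]tE.
  apply: bounded_byZr; first by rewrite invr_ge0.
  apply: bounded_byB; first exact: bounded_by_nonnegB.
  by apply: bounded_byZr => //; rewrite /t; lra.
have JomE : (2^-1 *: N - Q) *+ 2 = J * (1 - om).
  rewrite mulrBr mulr1 -omE mulrA JJ mul1r opprB addrA subrK mulrnBl.
  by rewrite -scaler_nat scalerA divff// scale1r.
move=> v; have : bounded_by (J * (1 - om)) (1 * t) by exact: bounded_byM.
move=> /(_ v); rewrite -JomE mulr2n adjOpE -mulr2n rnorm_mulr2n /t.
by move=> le2; lra.
Qed.

End MatchedBound.

End MatchedPair.

(** * Uniqueness of adjoints and inverses *)

Section Adjoints.
Context {R : realType} {A : cstarAlgType R}.

Lemma adjoint_unique (E F : innerProdModType A) (f : E -> F) (g : F -> E) :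
  is_adjoint f g -> adjoint f = g.
Proof.
move=> fg; have fg' : is_adjoint f (adjoint f) by exact: (xgetI _ fg).
by apply/funext => y; apply: inner_injr => x; rewrite -fg' fg.
Qed.

Lemma is_adjointC (E F : innerProdModType A) (f : E -> F) (g : F -> E) :
  is_adjoint f g -> is_adjoint g f.
Proof. by move=> fg x y; rewrite -star_inner -fg star_inner. Qed.

Lemma adjointable_adjoint (E F : innerProdModType A) (f : E -> F) :
  adjointable f -> is_adjoint f (adjoint f).
Proof. by case=> g fg; rewrite (adjoint_unique fg). Qed.

Lemma op_inv_unique (E : innerProdModType A) (f g : E -> E) :
  adjointable g -> cancel f g -> cancel g f -> op_inv f = g.
Proof.
move=> ag fg gf.
have gP : [set S : E -> E | [/\ adjointable S, S \o f = idfun &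
    f \o S = idfun]] g.
  by split=> //; apply/funext => x /=; rewrite ?fg ?gf.
have [_ inv_f _] := xgetI (cst 0) gP.
by apply/funext => x; rewrite -{1}[x]gf; have := congr1 (@^~ (g x)) inv_f.
Qed.

End Adjoints.

(** * Operators between submodules and their lifts to [H] *)

Section Compression.
Context {R : realType} {A : cstarAlgType R} {H : hilbertModType A}.
Implicit Types (V W : submodule H) (X Y : 'L(H)).

(** The default 0 is never reached when [X] maps [V] into [W], as the lemmas below assume. *)
Definition compress V W X (x : submod V) : submod W := insubd 0 (X (val x)).

Arguments compress : clear implicits.

Lemma inner_submodE V (x y : submod V) :
  inner x y = inner (val x) (val y) :> A.
Proof. by []. Qed.

Lemma submodP V (x : submod V) : submod_set V (val x).
Proof. exact/submod_predP/valP. Qed.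

Lemma val_insubd_submod V x :
  submod_set V x -> val (insubd (0 : submod V) x) = x.
Proof. by move=> Vx; rewrite val_insubd; case: ifPn => // /submod_predP[]. Qed.

Lemma val_compress V W X x :
  {homo X : y / submod_set V y >-> submod_set W y} ->
  val (compress V W X x) = X (val x).
Proof. by move=> VW; rewrite val_insubd_submod//; exact/VW/submodP. Qed.

Lemma compress_adjoint V W X :
  {homo X : y / submod_set V y >-> submod_set W y} ->
  {homo X^† : y / submod_set W y >-> submod_set V y} ->
  is_adjoint (compress V W X) (compress W V X^†).
Proof.
move=> VW WV x y; rewrite !inner_submodE !val_compress//.
exact: adjOp_adjE.
Qed.

Section Lift.
Variables (V : submodule H) (P : 'L(H)).
Hypotheses (Ps : P^† = P) (PP : P * P = P).
Hypothesis VP : forall x, submod_set V x <-> P x = x.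

Definition corestrict h : submod V := insubd 0 (P h).

Lemma val_corestrict h : val (corestrict h) = P h.
Proof. by rewrite val_insubd_submod//; apply/VP; rewrite -mul_adjOpE PP. Qed.

Lemma projection_val (x : submod V) : P (val x) = val x.
Proof. exact/VP/submodP. Qed.

Lemma corestrict_val x : corestrict (val x) = x.
Proof. by apply: val_inj; rewrite val_corestrict projection_val. Qed.

Lemma lift_is_adjoint (f g : submod V -> submod V) : is_adjoint f g ->
  @is_adjoint _ _ H H (fun h => val (f (corestrict h)))
    (fun h => val (g (corestrict h))).
Proof.
move=> fg h k; rewrite -(projection_val (f _)) adjOp_adjE Ps.
rewrite -(projection_val (g _)) [RHS]adjOp_adjEr Ps.
have := fg (corestrict h) (corestrict k).
by rewrite !inner_submodE !val_corestrict.
Qed.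

(** The lift extends [f] by zero on the kernel of [P]. *)
Lemma lift_adjOp (f g : submod V -> submod V) : is_adjoint f g ->
  exists2 F : 'L(H),
    [/\ F * P = F, P * F = F & forall x, F (val x) = val (f x)] &
    forall h, F^† h = val (g (corestrict h)).
Proof.
move=> /lift_is_adjoint fg; exists (AdjOp (ex_intro _ _ fg)); last first.
  have gf := is_adjointC fg.
  by move=> h; rewrite (@adjOp_adj_unique _ _ _ _ (AdjOp (ex_intro _ _ gf))).
split.
- apply: adjOp_ext => h; rewrite adjOpE /=; congr (val (f _)).
  by apply: val_inj; rewrite !val_corestrict -mul_adjOpE PP.
- by apply: adjOp_ext => h; rewrite adjOpE /= projection_val.
- by move=> x; rewrite /= corestrict_val.
Qed.

End Lift.
End Compression.

Arguments compress {R A H} V W X x.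

(** * Projections onto submodules *)

Section MatchedProjection.
Context {R : realType} {A : cstarAlgType R} {H : hilbertModType A}.

Lemma is_projectionP (f : H -> H) : is_projection f <->
  exists P : 'L(H), [/\ f = P, P^† = P & P * P = P].
Proof.
split=> [[af ff fs]|[P [-> Ps PP]]].
  exists (AdjOp af); split => //; apply: adjOp_ext => x.
    by rewrite -[LHS]/(adjoint f x) fs.
  by rewrite adjOpE /=; exact: (congr1 (@^~ x) ff).
split; first exact: adjOpP.
  by apply/funext => x; rewrite /= -mul_adjOpE PP.
by rewrite -[LHS]/(adjOp_fun P^†) Ps.
Qed.

(** Two projections with the same range satisfy $P P' = P'$ and $P' P = P$; the adjoint of the first
    relation identifies them. *)
Lemma proj_ontoE (V : submodule H) (P : 'L(H)) : P^† = P -> P * P = P ->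
  (forall x, submod_set V x <-> P x = x) -> proj_onto V = P.
Proof.
move=> Ps PP VP.
have rP (P' : 'L(H)) : P' * P' = P' -> range P' = V ->
    forall x, submod_set V x <-> P' x = x.
  move=> PP' <- x; split=> [[y _ <-]|<-]; last by exists x.
  by rewrite -mul_adjOpE PP'.
have PV : [set P' : H -> H | is_projection P' /\ range P' = V] P.
  split; first by apply/is_projectionP; exists P.
  apply/seteqP; split=> [_ [x _ <-]|x /VP <-]; last by exists x.
  by apply/VP; rewrite -mul_adjOpE PP.
rewrite /proj_onto; have [] := xgetI (cst 0) PV.
move=> /is_projectionP[P' [-> Ps' PP']] /(rP _ PP') VP'; congr adjOp_fun.
have PP'1 : P * P' = P'.
  apply: adjOp_ext => x; rewrite adjOpE; apply/VP/VP'.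
  by rewrite -mul_adjOpE PP'.
have P'P1 : P' * P = P.
  apply: adjOp_ext => x; rewrite adjOpE; apply/VP'/VP.
  by rewrite -mul_adjOpE PP.
by have := congr1 (@adjOp_adj _ _ H) PP'1; rewrite dagM Ps Ps' P'P1 => ->.
Qed.

End MatchedProjection.

(** * From the block definition to operators on [H] *)

Section MatchedProjectionBound.
Context {R : realType} {A : cstarAlgType R} {H : hilbertModType A}.

Lemma compress_inverse (V : submodule H) (P X Y : 'L(H))
    (f : submod V -> submod V) :
  (forall x, submod_set V x <-> P x = x) -> P * Y = Y * P -> Y^† = Y ->
  X * Y = 1 -> Y * X = 1 -> (forall x, val (f x) = X (val x)) ->
  op_inv f = compress V V Y.
Proof.
move=> VP PY Ys XY YX fX.
have VY : {homo Y : y / submod_set V y >-> submod_set V y}.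
  by move=> y /VP Py; apply/VP; rewrite -mul_adjOpE PY adjOpE Py.
apply: op_inv_unique.
- by exists (compress V V Y^†); apply: compress_adjoint => //; rewrite Ys.
- by move=> x; apply: val_inj; rewrite val_compress// fX -mul_adjOpE YX.
- by move=> x; apply: val_inj; rewrite fX val_compress// -mul_adjOpE XY.
Qed.

Section WithProjection.
Variables Q P : 'L(H).
Hypotheses (QQ : Q * Q = Q) (Ps : P^† = P) (PP : P * P = P).
Hypotheses (PQ : P * Q = Q) (QP : Q * P = P) (bQ : bounded Q).
Let T : 'L(H) := Q - P.
Let E := submod (ran_mod Q).
Let F := submod (ker_mod Q^†).

Let PT : P * T = T. Proof. by rewrite mulrBr PQ PP. Qed.
Let TP : T * P = 0. Proof. by rewrite mulrBl QP PP subrr. Qed.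
Let TdP : T^† * P = T^†. Proof. by rewrite -{1}Ps -dagM PT. Qed.
Let PTd : P * T^† = 0. Proof. by rewrite -{1}Ps -dagM TP dag0. Qed.
Let PQd : P * Q^† = P. Proof. by rewrite -{1}Ps -dagM QP Ps. Qed.
Let QdP : Q^† * P = Q^†. Proof. by rewrite -{1}Ps -dagM PQ. Qed.
Let Pcs : (1 - P)^† = 1 - P. Proof. by rewrite dagB dag1 Ps. Qed.
Let PcPc : (1 - P) * (1 - P) = 1 - P.
Proof. by rewrite mulrBr mulr1 mulrBl mul1r PP subrr subr0. Qed.

Let ranP x : submod_set (ran_mod Q) x <-> P x = x.
Proof.
split=> [[y _ <-]|Px]; first by rewrite -mul_adjOpE PQ.
by exists x => //; rewrite -Px -mul_adjOpE QP.
Qed.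

(** The relations $P Q^† = P$ and $Q^† P = Q^†$ give $Q^†$ and $P$ the same kernel. *)
Let kerP x : submod_set (ker_mod Q^†) x <-> (1 - P) x = x.
Proof.
have -> : ((1 - P) x = x) <-> (P x = 0).
  rewrite !adjOpE; split=> [/eqP|->]; last by rewrite subr0.
  by rewrite subr_eq addrC -subr_eq subrr => /eqP.
split=> [Qx|Px].
  by rewrite -PQd adjOpE (Qx : Q^† x = 0) raddf0.
by rewrite /= -[LHS]/(Q^† x) -QdP adjOpE Px raddf0.
Qed.

Let ran_homo (X : 'L(H)) : P * X = X * P ->
  {homo X : y / submod_set (ran_mod Q) y >-> submod_set (ran_mod Q) y}.
Proof.
by move=> XP y /ranP Py; apply/ranP; rewrite -mul_adjOpE XP adjOpE Py.
Qed.

Let Tran :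
  {homo T : y / submod_set (ker_mod Q^†) y >-> submod_set (ran_mod Q) y}.
Proof. by move=> y _; apply/ranP; rewrite -mul_adjOpE PT. Qed.

Let Tker :
  {homo T^† : y / submod_set (ran_mod Q) y >-> submod_set (ker_mod Q^†) y}.
Proof.
by move=> y _; apply/kerP; rewrite -mul_adjOpE mulrBl mul1r PTd subr0.
Qed.

Let T' : F -> E := compress _ _ T.

Let adjT' : adjoint T' = compress _ _ T^†.
Proof. by apply: adjoint_unique; exact: compress_adjoint. Qed.

Let TT1 : E -> E := (T' \o adjoint T') \+ idfun.

Let val_TT1 x : val (TT1 x) = (1 + T * T^†) (val x).
Proof. by rewrite /TT1 /= adjT' !val_compress// !adjOpE addrC. Qed.

Let bP : bounded P. Proof. by exists 1 => //; exact: bounded_by_projection. Qed.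
Let bT : bounded T. Proof. exact: boundedB. Qed.
Let nTT : nonneg (T * T^†).
Proof. by rewrite -{1}[T]dagK; apply/dagM_nonneg/bounded_dag. Qed.

Let B : E -> E := op_sqrt TT1.

(** A root exists, so the default of [op_sqrt] is excluded. As [op_pos] asks for the form $S^† S$, a
    fourth root [l] of $1 + T T^†$ is compressed to the range of [Q], where its square serves as the
    root. *)
Let B_sqrt : op_pos B /\ B \o B = TT1.
Proof.
have [k [nk k2 kY]] := nonneg_sqrt (nonnegD (@nonneg1 _ _ H) nTT).
have [l [nl l2 lY]] := nonneg_sqrt nk.
have Pk : k * P = P * k.
  apply: kY => //; rewrite mulrDl mulrDr mul1r mulr1.
  by rewrite -mulrA TdP mulrA PT.
have Pl : l * P = P * l by exact: lY.
pose l' : E -> E := compress _ _ l.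
have l'l' : is_adjoint l' l'.
  rewrite {2}/l' -(proj1 nl); apply: compress_adjoint; first exact: ran_homo.
  by rewrite (proj1 nl); exact: ran_homo.
have BP : [set S : E -> E | op_pos S /\ S \o S = TT1] (l' \o l').
  split; first by exists l'; [exists l' | rewrite (adjoint_unique l'l')].
  have lh := ran_homo (esym Pl).
  apply/funext => x; apply: val_inj; rewrite val_TT1 -k2 -l2 !expr2.
  by rewrite /= /l' !val_compress.
exact: (xgetI (cst 0) BP).
Qed.

(* [C] extends the operator [B] of the definition by the identity of [N(Q^†)],
   which makes all the entries of the block matrix operators on [H]. *)
Let matched_entries : exists C a e : 'L(H),
  [/\ nonneg C, P * C = C * P, C * C = 1 + T * T^†, bounded a & bounded e] /\
  [/\ a^† = a, e^† = e, a * C = 1 & C * a = 1] /\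
  [/\ e * (1 + C) = 1, (1 + C) * e = 1 & forall x : E, val (B x) = C (val x)].
Proof.
have [[S aS BE] BB] := B_sqrt.
(* [s] lifts [S], so $s^† s$ agrees with $B = S^† S$ on the range of [Q] and vanishes on the kernel
   of [P]. *)
have [s [sP Ps' sS] sd] := lift_adjOp Ps PP ranP (adjointable_adjoint aS).
have sdP : P * s^† = s^† by rewrite -{1}Ps -dagM sP.
have Pcs0 : (1 - P) * s = 0 by rewrite mulrBl mul1r Ps' subrr.
have Pcsd0 : (1 - P) * s^† = 0 by rewrite mulrBl mul1r sdP subrr.
have sPc0 : s^† * (1 - P) = 0 by rewrite -Pcs -dagM Pcs0 dag0.
have sB (x : E) : (s^† * s) (val x) = val (B x).
  by rewrite adjOpE sS sd (corestrict_val PP ranP) BE.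
have ssPc : s^† * s * (1 - P) = 0 by rewrite -mulrA mulrBr mulr1 sP subrr mulr0.
pose C := s^† * s + (1 - P).
(* The cross terms vanish because $s$ takes its values in the range of $P$; this form shows that [C]
   is nonnegative. *)
have CE : C = (s + (1 - P))^† * (s + (1 - P)).
  rewrite dagD Pcs mulrDl [s^† * (_ + _)]mulrDr [(1 - P) * (_ + _)]mulrDr.
  by rewrite sPc0 Pcs0 PcPc addr0 add0r.
have CP : P * C = C * P.
  rewrite [LHS]mulrDr [RHS]mulrDl mulrA sdP -[s^† * s * P]mulrA sP.
  by rewrite mulrBr mulrBl mulr1 mul1r.
have ss : (s^† * s) * (s^† * s) = T * T^† + P.
  have ssP : s^† * s * P = s^† * s by rewrite -mulrA sP.
  apply: adjOp_ext => h.
  rewrite -{2}ssP mulrA adjOpE -(val_corestrict PP ranP) [in LHS]adjOpE !sB.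
  have BBx x : val (B (B x)) = val (TT1 x) by rewrite -BB.
  rewrite BBx val_TT1 (val_corestrict PP ranP) -mul_adjOpE mulrDl mul1r.
  by rewrite -mulrA TdP addrC.
have CC : C * C = 1 + T * T^†.
  rewrite mulrDl [s^† * s * (_ + _)]mulrDr [(1 - P) * (_ + _)]mulrDr.
  rewrite ssPc PcPc ss addr0.
  rewrite [(1 - P) * (s^† * s)]mulrA Pcsd0 mul0r add0r.
  by rewrite -addrA [P + _]addrC subrK addrC.
have Cs : C^† = C by rewrite CE dagM dagK.
have bC : bounded C.
  apply: bounded_dagM; rewrite Cs CC; apply: boundedD; first exact: bounded1.
  exact: nonneg_bounded.
have nC : nonneg C.
  by rewrite CE; apply: dagM_nonneg; apply: bounded_dagM; rewrite -CE.
have [Y [Ys bY YC CY]] := nonneg_inv1D nTT.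
rewrite -CC in YC CY; have [Ca aC] := inv_of_sqr CY YC.
have [e [es be eC Ce]] := nonneg_inv1D nC.
exists C, (C * Y), e; split; first by split=> //; exact: boundedM.
split; split=> //.
  have Cad : C * (C * Y)^† = 1 by rewrite -{1}Cs -dagM aC dag1.
  by rewrite -[RHS]mulr1 -Cad mulrA aC mul1r.
move=> x; have Px : (1 - P) (val x) = 0.
  by rewrite !adjOpE (projection_val ranP) subrr.
by rewrite [RHS]adjOpE sB Px addr0.
Qed.

(** Each block entry is the compression of an operator on [H] built from [C], [a], [e] and [T], so
    that [matched_bound] applies. *)
Lemma matched_projection_bound M : ~ is_projection Q -> bounded_by Q M ->
  exists2 m : 'L(H), matched_projection Q = m & bounded_by (m - Q) M.
Proof.
move=> notP QM.
have Q0 : Q != 0.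
  apply/eqP => Q0; apply: notP; apply/is_projectionP; exists Q.
  by rewrite QQ Q0 dag0.
have [C [a [e [[nC CP CC ba be] [[as_ es aC Ca] [eC Ce BC]]]]]] :=
  matched_entries.
have aP : P * a = a * P by exact: commute_inv Ca aC CP.
have eP : P * e = e * P.
  by apply: commute_inv Ce eC _; rewrite mulrDr mulrDl mulr1 mul1r CP.
have Ce' : C * e = e * C.
  by apply: commute_inv Ce eC _; rewrite mulrDr mulrDl mulr1 mul1r.
have ae : a * e = e * a by apply/esym; apply: commute_inv Ca aC _; rewrite Ce'.
exists (2^-1 *: ((1 + C) * a * P + a * T + (T^† * a * P + T^† * (a * e) * T)));
  last exact: matched_bound.
have invB : op_inv B = compress (ran_mod Q) (ran_mod Q) a.
  exact: (compress_inverse (X := C) ranP).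
have invBB : op_inv (B \o (B \+ idfun)) =
    compress (ran_mod Q) (ran_mod Q) (a * e).
  apply: (compress_inverse (X := C * (1 + C)) ranP).
  - by rewrite mulrA aP -mulrA eP mulrA.
  - by rewrite dagM as_ es ae.
  - by rewrite ae mulrA -[C * _ * e]mulrA Ce mulr1.
  - by rewrite mulrA -[a * e * C]mulrA -Ce' mulrA aC mul1r eC.
  - by move=> x; rewrite /= BC /= BC addrC.
rewrite /matched_projection asboolF//; apply/funext => h.
rewrite (proj_ontoE Ps PP ranP).
pose x := corestrict (ran_mod Q) P h.
pose y := corestrict (ker_mod Q^†) (1 - P) h.
transitivity (2^-1 *: (val (((B \+ idfun) \o op_inv B) x + (op_inv B \o T') y)
  + val ((adjoint T' \o op_inv B) x +
         (adjoint T' \o op_inv (B \o (B \+ idfun)) \o T') y))).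
  by rewrite scalerDr.
rewrite invB invBB adjT'.
have vx : val x = P h by exact: val_corestrict PP ranP h.
(* [T] kills the range of [P], which is why the entries ending in [T] carry no factor [1 - P]. *)
have Ty : T (val y) = T h.
  rewrite (val_corestrict PcPc kerP) -mul_adjOpE.
  by rewrite mulrBr mulr1 TP subr0.
have va : {homo a : y / submod_set (ran_mod Q) y >-> submod_set (ran_mod Q) y}.
  exact: ran_homo.
have vae :
    {homo a * e : y / submod_set (ran_mod Q) y >-> submod_set (ran_mod Q) y}.
  by apply: ran_homo; rewrite mulrA aP -mulrA eP mulrA.
have vD (V : submodule H) (u v : submod V) : val (u + v) = val u + val v by [].
rewrite adjOpE; congr (_ *: _); rewrite !vD; congr (_ + _ + (_ + _)).
- transitivity (val (B (compress _ _ a x)) + val (compress _ (ran_mod Q) a x)).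
    by [].
  by rewrite BC val_compress// vx !adjOpE addrC.
- by rewrite /= !val_compress// Ty.
- by rewrite /= !val_compress// vx.
- by rewrite /= !val_compress// Ty.
Qed.

End WithProjection.
End MatchedProjectionBound.

(** * The norm inequalities *)

Section NormComparisons.
Context {R : realType} {A : cstarAlgType R} {H : hilbertModType A}.
Implicit Types P Q : 'L(H).

Lemma opnorm_idempotent_compl Q : Q * Q = Q -> Q != 0 ->
  (opnorm (1 - Q : 'L(H))%R <= opnorm Q)%E.
Proof.
by move=> QQ Q0; apply: opnorm_mono => r _; exact: idempotent_compl_bound.
Qed.

Lemma opnorm_compl_le_proj Q : Q * Q = Q ->
  (opnorm (1 - Q : 'L(H))%R <= opnorm (proj_onto (ker_mod Q) \- Q)%R)%E.
Proof.
move=> QQ; pose V := [set f : H -> H | is_projection f /\ range f = ker_mod Q].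
have [[P0 VP0]|noP] := pselect (exists f, V f).
  rewrite /proj_onto.
  have [/is_projectionP[P [-> Ps PP]] rP] := xgetI (cst 0) VP0.
  have PQc : P * (1 - Q) = 1 - Q.
    apply: adjOp_ext => x; have : range P ((1 - Q) x).
      by rewrite rP /= -[LHS]/((Q * (1 - Q)) x) mulrBr mulr1 QQ subrr.
    by case=> y _ Py; rewrite mul_adjOpE -Py -mul_adjOpE PP.
  have -> : 1 - Q = P * (P - Q).
    by rewrite mulrBr PP -{1}[P]mulr1 -mulrBr.
  apply: (@opnorm_mono _ _ _ _ (P - Q)) => r r0 PQr.
  rewrite -[r]mul1r; apply: bounded_byM => //; exact: bounded_by_projection.
(* Without such a projection, [proj_onto] is 0: although this never happens, the
   inequality then still holds, which saves constructing the projection. *)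
have -> : proj_onto (ker_mod Q) = cst 0.
  by rewrite /proj_onto xgetPN// => f Vf; apply: noP; exists f.
(* For [Q = 0] the kernel is [H], onto which the identity is a projection. *)
have Q0 : Q != 0.
  apply/eqP => Q0; apply: noP; exists (adjOp_fun (1 : 'L(H))); split.
    by apply/is_projectionP; exists 1; rewrite dag1 mulr1.
  by apply/seteqP; split=> [x _|x _]; [rewrite /= Q0 | exists x].
apply: (le_trans (opnorm_idempotent_compl QQ Q0)).
apply: (@opnorm_mono _ _ _ _ (0 - Q)) => r _; rewrite sub0r.
by move=> /bounded_byN; rewrite opprK.
Qed.

(** The difference is 0 for a projection, and an infinite norm leaves nothing to prove; a finite
    norm supplies the boundedness required to build the range projection. *)
Lemma opnorm_matched_projection_le Q : Q * Q = Q ->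
  (opnorm (matched_projection Q \- Q)%R <= opnorm Q)%E.
Proof.
move=> QQ; have [pQ|notP] := pselect (is_projection Q).
  rewrite /matched_projection asboolT//.
  apply: (@opnorm_mono _ _ _ (Q - Q)) => r r0 _; rewrite subrr => v.
  by rewrite rnorm0 mulr_ge0// rnorm_ge0.
have := @bounded_by_opnorm _ _ _ Q.
case: (opnorm Q) (opnorm_ge0 Q) => [r|_ _|//]; last by rewrite leey.
rewrite lee_fin => r0 /(_ r (lexx _)) Qr; have bQ : bounded Q by exists r.
have [P [Ps PP PQ QP]] := range_projection QQ bQ.
have [m -> mQ] := matched_projection_bound QQ Ps PP PQ QP bQ notP Qr.
exact: (@opnorm_le _ _ _ (m - Q)).
Qed.

End NormComparisons.

Local Open Scope ereal_scope.

(** The equality is restricted to [Q] other than 0 and the identity: unless [H] is trivial, one of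
    the two norms is then 0 and the other 1. *)
Theorem corollary4p13 (R : realType) (A : cstarAlgType R)
    (H : hilbertModType A) (Q : 'L(H)) (hQ : is_idempotent Q) :
  [/\ opnorm (matched_projection Q \- Q)%R <= opnorm Q,
      (Q <> cst 0%R :> (H -> H) -> Q <> idfun :> (H -> H) ->
        opnorm Q = opnorm (idfun \- Q)%R)
    & opnorm (idfun \- Q)%R <= opnorm (proj_onto (ker_mod Q) \- Q)%R].
Proof.
have QQ : (Q * Q = Q)%R.
  by apply: adjOp_ext => x; rewrite adjOpE; exact: (congr1 (@^~ x) hQ).
split; [exact: opnorm_matched_projection_le | | exact: opnorm_compl_le_proj].
move=> Q0 Q1; apply/eqP; rewrite eq_le; apply/andP; split; last first.
  apply: opnorm_idempotent_compl => //.
  by apply/eqP => Q00; apply: Q0; rewrite Q00.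
(* The reverse inequality is the same lemma for the idempotent [1 - Q], nonzero because [Q] is not
   the identity. *)
rewrite -[X in X <= _]/(opnorm (Q : 'L(H))) -{1}[Q](subKr 1%R).
apply: opnorm_idempotent_compl.
  by rewrite mulrBr mulr1 mulrBl mul1r QQ subrr subr0.
rewrite subr_eq0; apply/eqP => Q11; apply: Q1; rewrite -Q11; exact/funext.
Qed.
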